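(* Let $M$ be a $d$-dimensional closed Riemannian manifold with normalized Riemannian volume $m$, let $\beta>0$ and $f\in\mathrm{Diff}^{1+\beta}(M)$, and let $\mu$ be an ergodic $f$-invariant Borel probability measure on $M$. Assume that there exist $C>0$, $\alpha\in(0,1]$ and $\gamma>0$ such that for every $g\in\mathrm{H\ddot{o}l}_\alpha(M)$ and all integers $n,N\ge 1$, $$\left|\frac1N\sum_{k=n}^{n+N-1} m(g\circ f^k)-\mu(g)\right|\le C\,\|g\|_\alpha\, e^{-\gamma\min\{n,N\}}.$$ Then $\mu$ is weakly physical with a full basin.
   Context: $m$ is the Riemannian volume normalized so that $m(M)=1$; $m(g)=\int g\,dm$, $\mu(g)=\int g\,d\mu$. $\mathrm{Diff}^{1+\beta}(M)$ is the set of $C^1$ diffeomorphisms of $M$ whose derivative (and that of the inverse) is $\beta$-Hölder. $\mathrm{H\ddot{o}l}_\alpha(M)$ is the space of real-valued $\alpha$-Hölder functions on $M$, with the Hölder norm $\|\cdot\|_\alpha$ (sup norm plus Hölder seminorm). For a strictly increasing sequence $(n_k)_k\subseteq\mathbb N$, its upper density is $\overline d((n_k)_k)=\limsup_{N}\frac1N\#\{k:n_k\le N\}$. A Borel probability measure $\nu$ on $M$ is called weakly physical with basin $$B_\nu:=\left\{y\in M:\ \exists\, n_k\uparrow\infty \text{ with } \overline d((n_k)_k)=1 \text{ such that } \forall g\in C(M),\ \frac1{n_k}\sum_{j=0}^{n_k-1}g\circ f^j(y)\xrightarrow[k\to\infty]{}\int g\,d\nu\right\}$$ if $m(B_\nu)>0$.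 If $m(B_\nu)=1$, then $\nu$ is called weakly physical with a full basin. *)

(* Defs.v *)
(* MathComp-Analysis; the reals are an arbitrary realType R, and R^d is the
   type 'rV[R]_d of row vectors (so the Jacobian acts on the right:
   'D_u F x = u *m 'J F x). *)
From HB Require Import structures.
From mathcomp Require Import all_boot all_order all_algebra.
From mathcomp Require Import all_classical all_reals all_analysis.

Set Implicit Arguments.
Unset Strict Implicit.
Unset Printing Implicit Defensive.

Import Order.TTheory GRing.Theory Num.Theory.
Import numFieldNormedType.Exports.

Local Open Scope classical_set_scope.
Local Open Scope ring_scope.

Notation borel T := (g_sigma_algebraType (@open T)).

(* F is C^k on the open set U: C^0 is continuity, and F is C^(k+1) when it is
   differentiable with all its directional derivatives C^k. *)
Fixpoint Ck (R : realType) (V W : normedModType R) (k : nat) (U : set V)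
    (F : V -> W) : Prop :=
  match k with
  | 0 => forall x, U x -> {for x, continuous F}
  | k'.+1 => (forall x, U x -> differentiable F x) /\
             (forall v : V, Ck k' U (fun x => 'D_v F x))
  end.

Definition smooth_on (R : realType) (V W : normedModType R) (U : set V)
    (F : V -> W) : Prop := forall k, Ck k U F.

(* Closed (compact, boundaryless) d-dimensional Riemannian manifold, given by a
   smooth atlas. Charts are total functions, meaningful on [chart_dom i] only,
   with inverse [chart_inv i], meaningful on [chart i @` chart_dom i] only.
   [metric i v] is the Gram matrix, in the coordinates of the chart i, of the
   metric at the point of coordinates v. Connectedness is not required. The
   carrier is pointed because measurable types are. *)
Record closedRiemannianManifold (R : realType) (d : nat) := ClosedRiemannian {
  carrier :> ptopologicalType ;
  carrier_compact : compact [set: carrier] ;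
  carrier_hausdorff : hausdorff_space carrier ;
  chart_index : Type ;
  chart_dom : chart_index -> set carrier ;
  chart : chart_index -> carrier -> 'rV[R]_d ;
  chart_inv : chart_index -> 'rV[R]_d -> carrier ;
  chart_at : carrier -> chart_index ;
  chart_atP : forall x, chart_dom (chart_at x) x ;
  dom_open : forall i, open (chart_dom i) ;
  image_open : forall i, open (chart i @` chart_dom i) ;
  chartK : forall i x, chart_dom i x -> chart_inv i (chart i x) = x ;
  chart_continuous : forall i x, chart_dom i x ->
    {for x, continuous (chart i)} ;
  chart_inv_continuous : forall i x, chart_dom i x ->
    {for chart i x, continuous (chart_inv i)} ;
  transition_smooth : forall i j,
    smooth_on (chart i @` (chart_dom i `&` chart_dom j))
      (chart j \o chart_inv i) ;
  metric : chart_index -> 'rV[R]_d -> 'M[R]_d ;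
  metric_smooth : forall i, smooth_on (chart i @` chart_dom i) (metric i) ;
  metric_sym : forall i v, (chart i @` chart_dom i) v ->
    (metric i v)^T = metric i v ;
  metric_pos : forall i v (u : 'rV[R]_d),
    (chart i @` chart_dom i) v -> u != 0 ->
    0 < (u *m metric i v *m u^T) ord0 ord0 ;
  metric_transition : forall i j x, chart_dom i x -> chart_dom j x ->
    let J : 'M[R]_d := 'J (chart j \o chart_inv i) (chart i x) in
    metric i (chart i x) = J *m metric j (chart j x) *m J^T }.

(* Lebesgue measure of R^d as the iterated product of the Lebesgue measure of
   R: the clause for d.+1 is the library's product measure, with the product
   R * R^d identified with R^(1 + d). *)
Fixpoint lebesgue_vec (R : realType) (d : nat) : set 'rV[R]_d -> \bar R :=
  match d with
  | 0 => fun A => (\1_A (0 : 'rV[R]_0))%:E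
  | d'.+1 => fun A : set 'rV[R]_(1 + d') =>
      (\int[@lebesgue_measure R]_x
         lebesgue_vec [set y : 'rV[R]_d' | A (row_mx (x%:M : 'rV[R]_1) y)])%E
  end.

Definition lebesgue_borel (R : realType) (d : nat) :
  set (borel 'rV[R]_d) -> \bar R := @lebesgue_vec R d.

Section manifold.
Context {R : realType} {d : nat} (M : closedRiemannianManifold R d).

(* This determines vol on all Borel sets, since finitely many charts cover M. *)
Definition is_riemannian_volume (vol : {measure set (borel M) -> \bar R}) :=
  forall (i : chart_index M) (A : set (borel M)),
  measurable A -> A `<=` chart_dom i ->
  vol A = (\int[@lebesgue_borel R d]_(v in chart i @` A)
             (Num.sqrt (\det (metric i v)))%:E)%E.

Definition is_normalized_volume (m : probability (borel M) R) :=
  exists2 vol : {measure set (borel M) -> \bar R}, is_riemannian_volume vol &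
    forall A : set (borel M), measurable A ->
      m A = ((fine (vol setT))^-1%:E * vol A)%E.

Definition C1_arc (c : R -> M) : Prop :=
  exists U : set R, [/\ open U, `[0, 1] `<=` U,
    forall t, U t -> {for t, continuous c} &
    forall i : chart_index M, Ck 1 (U `&` c @^-1` chart_dom i) (chart i \o c)].

(* The Riemannian norm of the velocity does not depend on the chart, by
   metric_transition. *)
Definition speed (c : R -> M) (t : R) : R :=
  let i := chart_at (c t) in
  let u : 'rV[R]_d := derive1 (chart i \o c) t in
  Num.sqrt ((u *m metric i (chart i (c t)) *m u^T) ord0 ord0).

Definition arc_length (c : R -> M) : \bar R :=
  (\int[@lebesgue_measure R]_(t in `[0%R, 1%R]) (speed c t)%:E)%E.

(* A piecewise C^1 path is a list of C^1 arcs, each starting where the previous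
   one ends. *)
Fixpoint joins (x : M) (s : seq (R -> M)) (y : M) : Prop :=
  match s with
  | [::] => x = y
  | c :: s' => [/\ C1_arc c, c 0 = x & joins (c 1) s' y]
  end.

(* +oo between distinct connected components. *)
Definition rdist (x y : M) : \bar R :=
  ereal_inf [set (\sum_(c <- s) arc_length c)%E | s in [set s | joins x s y]].

(* The diagonal contributes the value 0 / 0 = 0. *)
Definition hoelder_seminorm (a : R) (g : M -> R) : \bar R :=
  ereal_sup [set (`|g p.1 - g p.2| / (fine (rdist p.1 p.2) `^ a))%:E
            | p in [set p : M * M | (rdist p.1 p.2 < +oo)%E]].

Definition hoelder_norm (a : R) (g : M -> R) : \bar R :=
  (ereal_sup [set `|g x|%:E | x in [set: M]] + hoelder_seminorm a g)%E.

Definition hoelder_space (a : R) : set (M -> R) :=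
  [set g | (hoelder_norm a g < +oo)%E].

Definition local_dom (f : M -> M) (i j : chart_index M) : set 'rV[R]_d :=
  chart i @` (chart_dom i `&` f @^-1` chart_dom j).

Definition local_rep (f : M -> M) (i j : chart_index M) : 'rV[R]_d -> 'rV[R]_d :=
  chart j \o f \o chart_inv i.

Definition C1_map (f : M -> M) : Prop :=
  continuous f /\ forall i j, Ck 1 (local_dom f i j) (local_rep f i j).

(* Locally in charts; on a compact manifold, for b <= 1, this is the
   chart-independent global condition. *)
Definition hoelder_derivative (b : R) (f : M -> M) : Prop :=
  forall i j u, local_dom f i j u ->
  exists K r : R, 0 < r /\ forall v w : 'rV[R]_d, ball u r v -> ball u r w ->
    `|'J (local_rep f i j) v - 'J (local_rep f i j) w| <= K * `|v - w| `^ b.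

Definition Diff1 (b : R) : set (M -> M) :=
  [set f | exists finv : M -> M, [/\ cancel f finv, cancel finv f,
     C1_map f /\ C1_map finv &
     hoelder_derivative b f /\ hoelder_derivative b finv]].

Definition invariant_measure (f : M -> M) (mu : probability (borel M) R) :=
  forall A : set (borel M), measurable A -> mu (f @^-1` A) = mu A.

Definition ergodic_measure (f : M -> M) (mu : probability (borel M) R) :=
  invariant_measure f mu /\
  forall A : set (borel M), measurable A -> f @^-1` A = A ->
    mu A = 0%E \/ mu A = 1%E.

(* For n strictly increasing, n k <= N implies k <= N, so the sum counts all
   the k with n k <= N. *)
Definition upper_density (n : nat -> nat) : \bar R :=
  limn_esup (fun N => ((\sum_(k < N.+1) (n k <= N))%N%:R / N%:R)%:E).

Definition basin (f : M -> M) (nu : probability (borel M) R) : set (borel M) :=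
  [set y | exists n : nat -> nat, [/\ {homo n : k l / (k < l)%N},
     upper_density n = 1%E &
     forall g : M -> R, continuous g ->
       ((n k)%:R^-1 * \sum_(j < n k) g (iter j f y)) @[k --> \oo]
         --> \int[nu]_x g x]].

Definition weakly_physical (m : probability (borel M) R) (f : M -> M)
    (nu : probability (borel M) R) : Prop :=
  measurable (basin f nu) /\ (0 < m (basin f nu))%E.

Definition weakly_physical_full (m : probability (borel M) R) (f : M -> M)
    (nu : probability (borel M) R) : Prop :=
  weakly_physical m f nu /\ m (basin f nu) = 1%E.

End manifold.

(* Main.v *)
(* The exponential rate gives, for every continuous g, the Cesaro convergence of
   m(g o f^k) to mu(g), because functions of Hoelder class are dense in C(M):
   rational lattice combinations of finitely many C^1 functions supported in
   charts, whose gradients are bounded in the Riemannian metric, already form a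
   countable dense family. For a window length w put
   H_w = |A_w g - mu(g)|, with A_w the Birkhoff average. Averaging A_w g along the
   orbit reproduces A_N g up to O(w/N), so the limsup over N of
   m(|A_N g - mu(g)|) is at most mu(H_w), which is small for a suitable w by
   ergodicity of mu (Garsia's maximal inequality). Hence A_N g -> mu(g) in L^1(m).
   By Markov's inequality, for almost every y the times at which finitely many
   Birkhoff averages deviate have density close to 0 at arbitrarily large scales,
   and a diagonal choice of good times has upper density 1. *)
Require Import Defs.
From HB Require Import structures.
From mathcomp Require Import all_boot all_order all_algebra.
From mathcomp Require Import all_classical all_reals all_analysis.
From mathcomp Require Import measurable_realfun zify lra.

Set Implicit Arguments.
Unset Strict Implicit.
Unset Printing Implicit Defensive.

Import Order.TTheory GRing.Theory Num.Theory.
Import numFieldNormedType.Exports.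

Local Open Scope classical_set_scope.
Local Open Scope ring_scope.

(** * Continuously differentiable functions *)

(** No absolute continuity between [m] and [mu] is available, so an almost-everywhere ergodic
    theorem for [mu] says nothing about [m]. Only integrals of continuous functions can be compared,
    which is why the ergodic theorem is used in mean, at one fixed window length. Only an upper
    Cesaro bound is transferred, since the function to be made small is nonnegative. The rate
    involves the Hoelder norm of an approximant, which may blow up as the approximation improves;
    each approximant is fixed before time tends to infinity, so only qualitative convergence
    survives. Convergence in L^1 without a rate does not give almost-everywhere convergence along
    all times, hence the passage to upper density. The definition of the basin quantifies over
    uncountably many sequences, so its measurability has to come from an exact countable
    description. *)

Section C1.
Context {R : realType}.
Implicit Types V W : normedModType R.

(** The first-order expansion of [f] at [x] is also one for [g]; uniqueness of the differential
    identifies its linear part. *)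
Lemma near_eq_differentiable V W (f g : V -> W) (x : V) :
  (\near x, f x = g x) -> differentiable f x -> differentiable g x.
Proof.
move=> fg df.
have fgx : g x = f x by rewrite (nbhs_singleton fg).
have gd : g \o shift x = cst (g x) + 'd f x +o_ 0 id.
  apply/eqaddoP => _/posnumP[e].
  have /eqaddoP/(_ _ (gt0 e)) := diff_locally df.
  have fg0 : \forall h \near 0, f (h + x) = g (h + x).
    by move: fg; rewrite (near_shift 0 x) /= subr0.
  apply: filterS2 fg0 => h fgh.
  by rewrite /= !fctE /= fgx fgh.
have gf := diff_unique (diff_continuous df) gd.
by apply/diff_locallyP; rewrite gf; split=> //; exact: diff_continuous.
Qed.

(** Differentiability is asked on a neighbourhood, so that differentiation rules hold near [x] and
    continuity can be read off the resulting formulas. *)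
Definition C1_at V W (f : V -> W) (x : V) :=
  (\near x, differentiable f x) /\ forall v, {for x, continuous ('D_v f)}.

Lemma C1_at_near_eq V W (f g : V -> W) x :
  (\near x, f x = g x) -> C1_at f x -> C1_at g x.
Proof.
move=> fg [fd fc]; split.
  by apply: filterS2 (near_join fg) fd => y; exact: near_eq_differentiable.
move=> v; have Dfg : \near x, 'D_v f x = 'D_v g x.
  by apply: filterS (near_join fg) => y; exact: near_eq_derive.
rewrite /prop_for /continuous_at -(nbhs_singleton Dfg).
by apply: cvg_trans (fc v); exact: near_eq_cvg.
Qed.

Lemma C1_at_differentiable V W (f : V -> W) x : C1_at f x -> differentiable f x.
Proof. by case=> /nbhs_singleton. Qed.

Lemma C1_at_continuous V W (f : V -> W) x : C1_at f x -> {for x, continuous f}.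
Proof. by move=> /C1_at_differentiable; exact: differentiable_continuous. Qed.

Lemma Ck1_at V W (U : set V) (f : V -> W) x :
  Ck 1 U f -> nbhs x U -> C1_at f x.
Proof.
move=> [fd fc] xU; split; first exact: filterS xU.
by move=> v; apply: fc; exact: nbhs_singleton.
Qed.

Lemma C1_at_cst V W (a : W) (x : V) : C1_at (cst a) x.
Proof.
split; first by near=> y; exact: differentiable_cst.
move=> v; have -> : 'D_v (cst a) = cst 0 :> (V -> W).
  by apply/funext => y; exact: derive_cst.
exact: cst_continuous.
Unshelve. all: by end_near. Qed.

Lemma C1_atP V W (f : V -> W) (df : V -> V -> W) x :
  (\near x, differentiable f x) ->
  (forall v, \near x, 'D_v f x = df v x) ->
  (forall v, {for x, continuous (df v)}) -> C1_at f x.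
Proof.
move=> fd Df dfc; split=> // v.
rewrite /prop_for /continuous_at (nbhs_singleton (Df v)).
apply: cvg_trans (dfc v); apply: near_eq_cvg.
by apply: filterS (Df v) => y ->.
Qed.

Lemma C1_atD V (f g : V -> R) x : C1_at f x -> C1_at g x -> C1_at (f + g) x.
Proof.
move=> [fd fc] [gd gc].
apply: (@C1_atP _ _ _ (fun v => 'D_v f \+ 'D_v g)).
- by apply: filterS2 fd gd => y; exact: differentiableD.
- move=> v; apply: filterS2 fd gd => y fy gy.
  by rewrite deriveD//; exact: diff_derivable.
- by move=> v; apply: continuousD.
Qed.

Lemma C1_atM V (f g : V -> R) x : C1_at f x -> C1_at g x -> C1_at (f * g) x.
Proof.
move=> Cf Cg; have [fd fc] := Cf; have [gd gc] := Cg.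
apply: (@C1_atP _ _ _ (fun v => (f \* 'D_v g) \+ (g \* 'D_v f))).
- by apply: filterS2 fd gd => y; exact: differentiableM.
- move=> v; apply: filterS2 fd gd => y fy gy.
  by rewrite deriveM//; exact: diff_derivable.
- have cf := C1_at_continuous Cf; have cg := C1_at_continuous Cg.
  by move=> v; exact: (continuousD (continuousM cf (gc v)) (continuousM cg (fc v))).
Qed.

Lemma C1_at_coord n (j : 'I_n) (x : 'rV[R]_n) :
  C1_at (fun v : 'rV[R]_n => v 0 j) x.
Proof.
apply: (@C1_atP 'rV[R]_n R _ (fun v : 'rV[R]_n => cst (v 0 j))).
- by near=> y; exact: differentiable_coord.
- move=> v; near=> y.
  rewrite deriveE; last exact: differentiable_coord.
  have @f : {linear 'rV[R]_n -> R}.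
    by exists (fun N : 'rV[R]_n => N 0 j); do 2![eexists]; do ?[constructor];
       rewrite ?mxE// => ? *; rewrite ?mxE//; move=> ?; rewrite !mxE.
  rewrite (_ : (fun _ => _) = f)// diff_lin//; exact: coord_continuous.
- by move=> v; exact: cst_continuous.
Unshelve. all: by end_near. Qed.

Lemma derive_rV n W (f : 'rV[R]_n -> W) a u : differentiable f a ->
  'D_u f a = \sum_j u 0 j *: 'D_('e_j) f a.
Proof.
move=> fa; rewrite deriveE// {1}[u]row_sum_delta linear_sum.
by apply: eq_bigr => j _; rewrite linearZ deriveE.
Qed.

Lemma derive_comp (U : normedModType R) V W (g : U -> V) (f : V -> W) x v :
  differentiable g x -> differentiable f (g x) ->
  'D_v (f \o g) x = 'D_('D_v g x) f (g x).
Proof.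
move=> gx fx; rewrite deriveE; last exact: differentiable_comp.
by rewrite diff_comp//= -deriveE// -deriveE.
Qed.

(** [C1_at] controls ['D_v f] for fixed [v] only, whereas the chain rule produces the moving
    direction ['D_v g y]. In R^n this direction is expanded on the basis, leaving finitely many
    fixed directions. *)
Lemma C1_at_comp n V W (g : V -> 'rV[R]_n) (f : 'rV[R]_n -> W) x :
  C1_at g x -> C1_at f (g x) -> C1_at (f \o g) x.
Proof.
move=> Cg Cf; have [gd gc] := Cg; have [fd fc] := Cf.
have gx := C1_at_continuous Cg.
have fgd : \near x, differentiable f (g x) by exact: gx fd.
apply: (@C1_atP _ _ _ (fun v y => \sum_j 'D_v g y 0 j *: 'D_('e_j) f (g y))).
- by apply: filterS2 gd fgd => y; exact: differentiable_comp.
- move=> v; apply: filterS2 gd fgd => y gy fy.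
  by rewrite derive_comp// derive_rV.
- move=> v; apply: cvg_big => [|j _]; first exact: add_continuous.
  apply: cvgZ; last exact: (@continuous_comp _ _ _ g ('D_('e_j) f) x gx (fc _)).
  apply: (@continuous_comp _ _ _ ('D_v g) (fun u => u 0 j)); first exact: gc.
  exact: coord_continuous.
Qed.

Lemma C1_at_compR V W (g : V -> R) (f : R -> W) x :
  C1_at g x -> C1_at f (g x) -> C1_at (f \o g) x.
Proof.
move=> Cg Cf; have [gd gc] := Cg; have [fd fc] := Cf.
have gx := C1_at_continuous Cg.
have fgd : \near x, differentiable f (g x) by exact: gx fd.
apply: (@C1_atP _ _ _ (fun v y => 'D_v g y *: 'D_1 f (g y))).
- by apply: filterS2 gd fgd => y; exact: differentiable_comp.
- move=> v; apply: filterS2 gd fgd => y gy fy.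
  by rewrite derive_comp// !deriveE// -linearZ/= /GRing.scale/= mulr1.
- move=> v; apply: cvgZ; first exact: gc.
  exact: (@continuous_comp _ _ _ g ('D_1 f) x gx (fc _)).
Qed.

(** Profile of the bump functions: squaring makes the positive part C^1 at 0. *)
Definition sqpos (s : R) : R := (Num.max s 0) ^+ 2.

Lemma is_derive_sqpos y : is_derive y (1 : R) sqpos (2 * Num.max y 0).
Proof.
have [y0|y0|->] := ltgtP y 0.
- rewrite mulr0; apply: (@near_eq_is_derive _ _ _ (cst 0)).
  near=> z; rewrite /sqpos max_r ?expr0n//; near: z.
  by apply: filterS (lt_nbhsl y0) => z /ltW.
- apply: (@near_eq_is_derive _ _ _ (@id R ^+ 2)).
    near=> z; rewrite /sqpos max_l//; near: z.
    by apply: filterS (lt_nbhsr y0) => z /ltW.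
  have := is_deriveX 2 (is_derive_id y (1 : R)).
  by rewrite /GRing.scale/= mulr1.
- suff H : (fun h => h^-1 *: ((sqpos \o shift (0 : R)) (h *: (1 : R)) - sqpos 0))
      @ 0^' --> (0 : R).
    rewrite mulr0; apply: DeriveDef; last exact: cvg_lim H.
    by apply/cvg_ex; exists 0.
  apply/cvgrPdist_le => e e0; near=> h.
  rewrite /= /sqpos maxxx expr0n/= subr0 sub0r normrN addr0.
  have he : `|h| <= e.
    by near: h; apply: dnbhs0_le.
  have h0 : h != 0 by near: h; exact: nbhs_dnbhs_neq.
  rewrite /GRing.scale/= mulr1 normrM normfV ler_pdivrMl ?normr_gt0//.
  rewrite ger0_norm ?sqr_ge0// (@le_trans _ _ (`|h| ^+ 2))//.
    rewrite ler_sqr ?nnegrE ?le_max ?lexx ?orbT ?normr_ge0//.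
    by rewrite ge_max ler_norm normr_ge0.
  by rewrite expr2 ler_wpM2l ?normr_ge0.
Unshelve. all: by end_near. Qed.

Lemma C1_at_sqpos x : C1_at sqpos x.
Proof.
apply: (@C1_atP R R _ (fun v y : R => v * (2 * Num.max y 0))).
- by near=> y; apply/derivable1_diffP; have [] := is_derive_sqpos y.
- move=> v; near=> y.
  have dy : differentiable sqpos y.
    by apply/derivable1_diffP; have [] := is_derive_sqpos y.
  rewrite deriveE// -[v in 'd _ _ v]mulr1 linearZ -deriveE//.
  by rewrite (derive_val (is_derive := is_derive_sqpos y)).
- move=> v; apply: cvgMr; apply: cvgMr; apply: continuous_max => //.
  exact: cst_continuous.
Unshelve. all: by end_near. Qed.
End C1.

(** * Coercivity of positive definite quadratic forms *)

Section quad.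
Context {R : realType}.

Lemma ler_coord_norm m n (A : 'M[R]_(m, n)) i j : `|A i j| <= `|A|.
Proof.
rewrite [leRHS]mx_normrE.
exact: (le_bigmax _ (fun ij : 'I_m * 'I_n => `|A ij.1 ij.2|) (i, j)).
Qed.

Definition quad n (A : 'M[R]_n) (u : 'rV[R]_n) : R := (u *m A *m u^T) 0 0.

Lemma quadE n (A : 'M[R]_n) u : quad A u = \sum_j \sum_i u 0 i * A i j * u 0 j.
Proof.
rewrite /quad mxE; apply: eq_bigr => j _; rewrite !mxE mulr_suml.
by apply: eq_bigr => i _.
Qed.

Lemma quadZ n (A : 'M[R]_n) a u : quad A (a *: u) = a ^+ 2 * quad A u.
Proof. by rewrite /quad linearZ /= -scalemxAl -scalemxAr -scalemxAl !mxE mulrA. Qed.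

Lemma quadB n (A B : 'M[R]_n) u : quad (A - B) u = quad A u - quad B u.
Proof.
rewrite !quadE -sumrB; apply: eq_bigr => j _; rewrite -sumrB.
by apply: eq_bigr => i _; rewrite !mxE mulrBr mulrBl.
Qed.

Lemma quad_le n (A : 'M[R]_n) u : `|quad A u| <= n%:R ^+ 2 * `|A| * `|u| ^+ 2.
Proof.
rewrite quadE (le_trans (ler_norm_sum _ _ _))//.
have -> : n%:R ^+ 2 * `|A| * `|u| ^+ 2 =
    \sum_(j < n) \sum_(i < n) `|A| * `|u| ^+ 2.
  by rewrite !sumr_const !card_ord -mulrnA -[RHS]mulr_natl natrM -expr2 mulrA.
apply: ler_sum => j _; rewrite (le_trans (ler_norm_sum _ _ _))//.
apply: ler_sum => i _; rewrite !normrM mulrAC mulrC.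
by rewrite ler_pM ?mulr_ge0 ?normr_ge0 ?ler_coord_norm// expr2 ler_pM ?normr_ge0 ?ler_coord_norm.
Qed.

Lemma continuous_sum_at (T : topologicalType) (I : finType) (F : I -> T -> R) x :
  (forall i, {for x, continuous (F i)}) ->
  {for x, continuous (fun y => \sum_i F i y)}.
Proof.
move=> cF; rewrite /prop_for /continuous_at.
by apply: cvg_big => [|i _]; [exact: add_continuous|exact: cF].
Qed.

Lemma quad_continuous n (A : 'M[R]_n) : continuous (quad A).
Proof.
move=> u; rewrite (_ : quad A = fun u => \sum_j \sum_i u 0 i * A i j * u 0 j).
  apply: continuous_sum_at => j; apply: continuous_sum_at => i.
  have cu k : {for u, continuous (fun v : 'rV[R]_n => v 0 k)}.
    exact: coord_continuous.
  by apply: continuousM => //; apply: continuousM => //; exact: cst_continuous.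
by apply/funext => v; exact: quadE.
Qed.

Lemma closed_bounded_rV_compact n (A : set 'rV[R]_n) r : closed A ->
  (forall u, A u -> `|u| <= r) -> compact A.
Proof.
move=> cA Ar; apply: bounded_closed_compact => //.
exists r; split; first exact: num_real.
by move=> x /ltW rx u /Ar /le_trans; exact.
Qed.

(** By homogeneity the minimum over the compact unit sphere decides; the sphere is empty in
    dimension 0. *)
Lemma quad_coercive n (A : 'M[R]_n) : (forall u, u != 0 -> 0 < quad A u) ->
  exists2 l, 0 < l & forall u, l * `|u| ^+ 2 <= quad A u.
Proof.
move=> Apos; pose S := [set u : 'rV[R]_n | `|u| = 1].
have nS u : u != 0 -> S (`|u|^-1 *: u).
  by move=> u0; rewrite /S /= normrZ normfV normr_id mulVf// normr_eq0.
have quad0 : quad A 0 = 0 by rewrite /quad !mul0mx mxE.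
have [[u1 Su1]|S0] := pselect (S !=set0); last first.
  exists 1 => // u; have [->|/nS Su] := eqVneq u 0.
    by rewrite normr0 expr0n/= mulr0 quad0.
  by exfalso; apply: S0; eexists; exact: Su.
have cS : compact S.
  apply: (@closed_bounded_rV_compact _ _ 1) => [|u ->//].
  rewrite (_ : S = (fun u : 'rV[R]_n => `|u|) @^-1` [set 1]) //.
  apply: preimage_closed; first by move=> u _; exact: norm_continuous.
  exact: closed_eq.
have [|u0] := compact_EVT_min _ cS (continuous_subspaceT (@quad_continuous n A)).
  by exists u1.
rewrite inE => Su0 u0min; exists (quad A u0).
  by apply: Apos; rewrite -normr_eq0 Su0 oner_eq0.
move=> u; have [->|u_neq0] := eqVneq u 0.
  by rewrite normr0 expr0n/= mulr0 quad0.
have := u0min _ (mem_set (nS _ u_neq0)); rewrite quadZ exprVn mulrC.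
by rewrite ler_pdivlMr// exprn_gt0// normr_gt0.
Qed.

Lemma quad_locally_coercive n (A : 'rV[R]_n -> 'M[R]_n) v0 :
  {for v0, continuous A} -> (forall u, u != 0 -> 0 < quad (A v0) u) ->
  exists2 l, 0 < l & \forall v \near v0, forall u, l * `|u| ^+ 2 <= quad (A v) u.
Proof.
move=> cA /quad_coercive[l l0 hl].
exists (l / 2); first by rewrite divr_gt0.
(* Matrices this close change the form by at most half of the coercivity bound, uniformly in [u];
   the summand 1 keeps the divisor positive in dimension 0. *)
have d0 : 0 < l / 2 / (n%:R ^+ 2 + 1).
  by rewrite !divr_gt0// ltr_wpDl// ?sqr_ge0.
have /cvgrPdist_le/(_ _ d0) := cA; apply: filterS => v Av u.
have quadBE : quad (A v) u = quad (A v0) u - quad (A v0 - A v) u.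
  by rewrite quadB subKr.
rewrite quadBE; have := quad_le (A v0 - A v) u; have := hl u.
have : n%:R ^+ 2 * `|A v0 - A v| * `|u| ^+ 2 <= l / 2 * `|u| ^+ 2.
  rewrite ler_wpM2r ?sqr_ge0//.
  rewrite (@le_trans _ _ ((n%:R ^+ 2 + 1) * `|A v0 - A v|))//.
    by rewrite ler_wpM2r// lerDl.
  by rewrite mulrC -ler_pdivlMr// ltr_wpDl// sqr_ge0.
have := ler_norm (quad (A v0 - A v) u).
lra.
Qed.
End quad.

(** * Density of lattice combinations *)

Section lattice.
Context {R : realType} {T : ptopologicalType} {I : finType}.
Variable phi : I -> T -> R.

(* A pair (p, s) encodes a maximum (max_code) or a minimum (lattice_code) over the
   nonempty list p :: s. *)
Definition affine_code : Type := (rat * rat * option I)%type.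
Definition max_code : Type := (affine_code * seq affine_code)%type.
Definition lattice_code : countType :=
  ((rat * rat * option I) * seq (rat * rat * option I) *
   seq ((rat * rat * option I) * seq (rat * rat * option I)))%type.

Definition affine_fun (p : affine_code) (x : T) : R :=
  ratr p.1.1 + ratr p.1.2 * (if p.2 is Some i then phi i x else 0).

Definition max_fun (p : max_code) (x : T) : R :=
  foldr (fun q r => Num.max (affine_fun q x) r) (affine_fun p.1 x) p.2.

Definition lattice_fun (p : lattice_code) (x : T) : R :=
  foldr (fun q r => Num.min (max_fun q x) r) (max_fun p.1 x) p.2.

Lemma lattice_fun_ind (P : (T -> R) -> Prop) :
  (forall a, P (cst a)) ->
  (forall a b i, P (fun x => a + b * phi i x)) ->
  (forall f g, P f -> P g -> P (fun x => Num.max (f x) (g x))) ->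
  (forall f g, P f -> P g -> P (fun x => Num.min (f x) (g x))) ->
  forall p, P (lattice_fun p).
Proof.
move=> Pcst Paff Pmax Pmin.
have Pa p : P (affine_fun p).
  case: p => [[a b] [i|]]; rewrite /affine_fun/=; first exact: Paff.
  by have := Pcst (ratr a); congr (P _); apply/funext => x; rewrite mulr0 addr0.
have Pm p : P (max_fun p).
  case: p => p s; elim: s => [|q s IH]; first exact: Pa.
  exact: Pmax (Pa q) IH.
case=> p s; elim: s => [|q s IH]; first exact: Pm.
exact: Pmin (Pm q) IH.
Qed.

Hypothesis cT : compact [set: T].
Hypothesis cphi : forall i, continuous (phi i).
Hypothesis phi_sep : forall x y, (forall i, phi i x = phi i y) -> x = y.

Lemma affine_fun_continuous p : continuous (affine_fun p).
Proof.
case: p => [[a b] k] x.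
have ck : {for x, continuous (fun x => if k is Some i then phi i x else 0 : R)}.
  by case: k => [i|]; [exact: cphi|exact: cst_continuous].
rewrite (_ : affine_fun _ = cst (ratr a) \+
  (cst (ratr b) \* (fun x => if k is Some i then phi i x else 0)))//.
apply: continuousD; first exact: cst_continuous.
by apply: continuousM => //; exact: cst_continuous.
Qed.

Lemma max_fun_continuous p : continuous (max_fun p).
Proof.
case: p => p s; elim: s => [|q s IH]; first exact: affine_fun_continuous.
move=> x; apply: (@continuous_max _ _ (affine_fun q) (max_fun (p, s))).
  exact: affine_fun_continuous.
exact: IH.
Qed.

Lemma lattice_fun_continuous p : continuous (lattice_fun p).
Proof.
case: p => p s; elim: s => [|q s IH]; first exact: max_fun_continuous.
move=> x; apply: (@continuous_min _ _ (max_fun q) (lattice_fun (p, s))).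
  exact: max_fun_continuous.
exact: IH.
Qed.

Lemma open_lt_fun (f g : T -> R) : continuous f -> continuous g ->
  open [set z | f z < g z].
Proof.
move=> cf cg; rewrite (_ : mkset _ = (g \- f) @^-1` [set t | 0 < t]).
  apply: open_comp; last exact: open_gt.
  by move=> z _; apply: continuousB; [exact: cg|exact: cf].
by apply/seteqP; split => z /=; rewrite subr_gt0.
Qed.

Lemma compact_open_seq (U : T -> set T) :
  (forall y, open (U y)) -> (forall y, U y y) ->
  exists s : seq T, forall z, exists2 y, y \in s & U y z.
Proof.
move=> oU Uy; move: cT; rewrite compact_cover.
move=> /(_ T setT U) [] => [y _//|y _|D _ cD]; first by exists y.
by exists (finmap.enum_fset D) => z; have [y] := cD z Logic.I; exists y.
Qed.

Lemma ratr_approx (a e : R) : 0 < e -> exists q : rat, `|ratr q - a| < e.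
Proof.
move=> e0; have /rat_in_itvoo[q] : a - e < a + e by lra.
by rewrite in_itv/= => aq; exists q; rewrite ltr_distl.
Qed.

(** A separating [phi i] lets one solve the linear system for the two values; its coefficients are
    then rounded to rationals. If [x = y], a constant does. *)
Lemma affine_fun_interp (x y : T) (u v e : R) : 0 < e -> (x = y -> u = v) ->
  exists p, `|affine_fun p x - u| < e /\ `|affine_fun p y - v| < e.
Proof.
move=> e0 uv; have [xy|xy] := pselect (x = y).
  have [q qu] := ratr_approx u e0; exists (q, 0, None).
  by rewrite /affine_fun/= mulr0 addr0 -uv.
have [i pxy] : exists i, phi i x != phi i y.
  apply/not_existsP => h; apply: xy; apply: phi_sep => i.
  by apply/eqP; apply: contra_notT (h i).
set px := phi i x in pxy; set py := phi i y in pxy.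
have pxy0 : px - py != 0 by rewrite subr_eq0.
pose b := (u - v) / (px - py); pose a := u - b * px.
have bu : a + b * px = u by rewrite /a subrK.
have bv : a + b * py = v.
  have : b * (px - py) = u - v by rewrite /b divfK.
  by rewrite /a; lra.
pose K := `|px| + `|py| + 1.
have K0 : 0 < K by rewrite ltr_wpDl// addr_ge0.
have [qa hqa] := ratr_approx a (divr_gt0 e0 (ltr0Sn R 1)).
(* The slope multiplies values of size at most [K], hence its finer tolerance. *)
have [qb hqb] := ratr_approx b (divr_gt0 (divr_gt0 e0 (ltr0Sn R 1)) K0).
have main t w : `|t| <= K -> a + b * t = w -> `|ratr qa + ratr qb * t - w| < e.
  move=> tK <-; rewrite (_ : _ - _ = (ratr qa - a) + (ratr qb - b) * t); last lra.
  rewrite (le_lt_trans (ler_normD _ _))// [ltRHS]splitr ltr_leD// normrM.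
  rewrite (@le_trans _ _ (`|ratr qb - b| * K))// ?ler_wpM2l//.
  by rewrite -ler_pdivlMr// ltW.
have := normr_ge0 px; have := normr_ge0 py => ? ?.
exists (qa, qb, Some i); split; rewrite /affine_fun/=; apply: main => //; rewrite /K; lra.
Qed.

Lemma max_fun_ge p s q x : q \in p :: s -> affine_fun q x <= max_fun (p, s) x.
Proof.
elim: s => [|r s IH]; rewrite /max_fun/= !inE; first by move=> /eqP ->.
rewrite le_max => /or3P[qp|/eqP->|qs]; rewrite ?lexx//.
  by rewrite IH ?orbT// inE qp.
by rewrite IH ?orbT// inE qs orbT.
Qed.

Lemma max_fun_lt p s x c : (forall q, q \in p :: s -> affine_fun q x < c) ->
  max_fun (p, s) x < c.
Proof.
elim: s => [|r s IH] h; first by apply: h; rewrite inE.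
rewrite /max_fun/= gt_max h ?inE ?eqxx ?orbT//=; apply: IH => q.
by rewrite inE => /orP[qp|qs]; apply: h; rewrite !inE ?qp// qs !orbT.
Qed.

Lemma lattice_fun_le p s q x : q \in p :: s -> lattice_fun (p, s) x <= max_fun q x.
Proof.
elim: s => [|r s IH]; rewrite /lattice_fun/= !inE; first by move=> /eqP ->.
rewrite ge_min => /or3P[qp|/eqP->|qs]; rewrite ?lexx//.
  by rewrite IH ?orbT// inE qp.
by rewrite IH ?orbT// inE qs orbT.
Qed.

Lemma lattice_fun_gt p s x c : (forall q, q \in p :: s -> c < max_fun q x) ->
  c < lattice_fun (p, s) x.
Proof.
elim: s => [|r s IH] h; first by apply: h; rewrite inE.
rewrite /lattice_fun/= lt_min h ?inE ?eqxx ?orbT//=; apply: IH => q.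
by rewrite inE => /orP[qp|qs]; apply: h; rewrite !inE ?qp// qs !orbT.
Qed.

(* Stone's argument: for fixed x a finite maximum over y of functions matching h
   at x and y, then a finite minimum over x. *)
Lemma lattice_fun_dense (h : T -> R) (e : R) : continuous h -> 0 < e ->
  exists p, forall x, `|lattice_fun p x - h x| < e.
Proof.
move=> ch e0.
have interp x y : exists p,
    affine_fun p x < h x + e /\ h y - e < affine_fun p y.
  have [|p [+ +]] := @affine_fun_interp x y (h x) (h y) e e0; first by move=> ->.
  by rewrite !ltr_distl => /andP[_ ?] /andP[? _]; exists p.
have upper x : exists p : max_code,
    max_fun p x < h x + e /\ forall z, h z - e < max_fun p z.
  have [P hP] := choice (interp x).
  have [||s hs] := @compact_open_seq (fun y => [set z | h z - e < affine_fun (P y) z]).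
  - move=> y; apply: (@open_lt_fun (h \- cst e)) => [z|].
      by apply: continuousB; [exact: ch|exact: cst_continuous].
    exact: affine_fun_continuous.
  - by move=> y; have [] := hP y.
  exists (P x, map P s); split.
    by apply: max_fun_lt => q; rewrite inE => /predU1P[->|/mapP[y _ ->]];
      [have [] := hP x|have [] := hP y].
  move=> z; have [y ys hy] := hs z; apply: lt_le_trans hy _.
  by apply: max_fun_ge; rewrite inE map_f ?orbT.
have [P hP] := choice upper.
have [||s hs] := @compact_open_seq (fun x => [set z | max_fun (P x) z < h z + e]).
- move=> y; apply: (@open_lt_fun _ (h \+ cst e)) => [|z].
    exact: max_fun_continuous.
  by apply: continuousD; [exact: ch|exact: cst_continuous].
- by move=> y; have [] := hP y.
(* [P point] only makes the coded list nonempty; the lower bound holds for every member. *)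
exists (P point, map P s) => z; rewrite ltr_distl; apply/andP; split.
  by apply: lattice_fun_gt => q; rewrite inE => /predU1P[->|/mapP[y _ ->]];
    [have [_ /(_ z)] := hP point|have [_ /(_ z)] := hP y].
have [y ys hy] := hs z; apply: le_lt_trans hy.
by apply: lattice_fun_le; rewrite inE map_f ?orbT.
Qed.
End lattice.

(** * Functions with bounded Riemannian gradient *)

Section gradient.
Context {R : realType} {d : nat} (M : closedRiemannianManifold R d).

(** The Riemannian gradient has norm at most [K]: [quad] of the Gram matrix is the squared
    Riemannian length of [u]. Asking this in every chart lets a curve be followed through whichever
    chart contains it. *)
Definition C1_lipschitz (K : R) (phi : M -> R) := forall i x, chart_dom i x ->
  C1_at (phi \o @chart_inv _ _ M i) (chart i x) /\
  forall u, `|'D_u (phi \o @chart_inv _ _ M i) (chart i x)| <=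
    K * Num.sqrt (quad (metric i (chart i x)) u).

Lemma nbhs_chart_dom (i : chart_index M) (x : M) :
  chart_dom i x -> nbhs x (chart_dom i).
Proof. by move=> ix; apply: open_nbhs_nbhs; split=> //; exact: dom_open. Qed.

Lemma nbhs_chart_image (i : chart_index M) (x : M) :
  chart_dom i x -> nbhs (chart i x) (chart i @` chart_dom i).
Proof.
move=> ix; apply: open_nbhs_nbhs; split; first exact: image_open.
by exists x.
Qed.

Lemma chart_inv_near (i : chart_index M) (x : M) (A : set M) :
  chart_dom i x -> nbhs x A -> \forall v \near chart i x, A (chart_inv i v).
Proof.
move=> ix xA; apply: (chart_inv_continuous ix).
by rewrite (chartK ix).
Qed.

Lemma C1_lipschitz_continuous K (phi : M -> R) :
  C1_lipschitz K phi -> continuous phi.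
Proof.
move=> Lphi x; pose i := chart_at x; have ix := chart_atP x.
have [/C1_at_continuous cphi _] := Lphi i x ix.
rewrite /continuous_at -[in X in _ --> X](chartK ix).
have E : \near x, phi (chart_inv i (chart i x)) = phi x.
  by apply: filterS (nbhs_chart_dom ix) => y iy; rewrite (chartK iy).
apply: cvg_trans (near_eq_cvg E) _.
exact: (@continuous_comp _ _ _ (chart i) (phi \o chart_inv i) x
          (chart_continuous ix) cphi).
Qed.

Lemma C1_lipschitz_along K (phi : M -> R) (c : R -> M) (U : set R) t :
  C1_lipschitz K phi -> open U -> U t -> {for t, continuous c} ->
  (forall i : chart_index M, Ck 1 (U `&` c @^-1` chart_dom i) (chart i \o c)) ->
  C1_at (phi \o c) t /\ `|'D_1 (phi \o c) t| <= K * speed c t.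
Proof.
move=> Lphi oU Ut ct cC1; pose i := chart_at (c t).
have ix : chart_dom i (c t) := chart_atP (c t).
have [Cphi Dphi] := Lphi i _ ix.
have tdom : nbhs t (c @^-1` chart_dom i) := ct _ (nbhs_chart_dom ix).
have Cc : C1_at (chart i \o c) t.
  apply: Ck1_at (cC1 i) _; apply: filterI => //.
  by apply: open_nbhs_nbhs.
have E : \near t, ((phi \o chart_inv i) \o (chart i \o c)) t = (phi \o c) t.
  by apply: filterS tdom => s sdom; rewrite /= (chartK sdom).
split; first by apply: C1_at_near_eq E _; exact: C1_at_comp.
rewrite -(near_eq_derive _ E) derive_comp; last 2 first.
- exact: C1_at_differentiable.
- exact: C1_at_differentiable.
have -> : speed c t =
    Num.sqrt (quad (metric i (chart i (c t))) ('D_1 (chart i \o c) t)).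
  by rewrite /speed derive1E.
exact: Dphi.
Qed.

Lemma arc_length_ge0 (c : R -> M) : (0 <= arc_length c)%E.
Proof. by apply: integral_ge0 => t _; rewrite lee_fin sqrtr_ge0. Qed.

(* No measurability is needed: the integral of a nonnegative function is the
   supremum of the integrals of the simple functions below it. *)
Lemma ge0_le_integral_nonmeas dsp (T : measurableType dsp)
    (mu : {measure set T -> \bar R}) (D : set T) (g h : T -> \bar R) :
  (forall x, D x -> 0 <= g x)%E -> (forall x, D x -> g x <= h x)%E ->
  (\int[mu]_(x in D) g x <= \int[mu]_(x in D) h x)%E.
Proof.
move=> g0 gh; have h0 x : D x -> (0 <= h x)%E.
  by move=> Dx; rewrite (le_trans (g0 _ Dx)) ?gh.
rewrite !ge0_integralE//; apply: ereal_sup_le => _ [s /= sg <-].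
exists s => // x; rewrite (le_trans (sg x))// !patchE.
by case: ifPn => //; rewrite inE => /gh.
Qed.

(** Fundamental theorem of calculus along the arc, with the gradient bound under the integral
    sign. *)
Lemma C1_lipschitz_arc K (phi : M -> R) (c : R -> M) : 0 < K ->
  C1_lipschitz K phi -> C1_arc c ->
  ((K^-1 * `|phi (c 1) - phi (c 0)|)%:E <= arc_length c)%E.
Proof.
move=> K0 Lphi [U [oU U01 cc cC1]].
have along t : `[0, 1]%classic t -> C1_at (phi \o c) t /\ `|'D_1 (phi \o c) t| <= K * speed c t.
  move=> /U01 Ut; exact: (C1_lipschitz_along Lphi oU Ut (cc _ Ut) cC1).
have cD : {within `[0, 1], continuous ('D_1 (phi \o c))}.
  apply: continuous_in_subspaceT => t; rewrite inE => /along[[_ h] _].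
  exact: h.
have cF t : `[0, 1]%classic t -> {for t, continuous (phi \o c)}.
  by move=> /along[/C1_at_continuous].
have := @continuous_FTC2 R ('D_1 (phi \o c)) (phi \o c) 0 1 ltr01 cD.
move=> FTC.
have {}FTC : (\int[lebesgue_measure]_(x in `[0%R, 1%R]) ('D_1 (phi \o c) x)%:E =
    (phi (c 1))%:E - (phi (c 0))%:E)%E.
  apply: FTC.
  - split.
    + move=> t t01; apply/derivable1_diffP.
      have /along[/C1_at_differentiable//] : `[0, 1]%classic t.
      exact: subset_itv_oo_cc.
    + by apply: cvg_at_right_filter; apply: cF; rewrite /= in_itv/= lexx ler01.
    + by apply: cvg_at_left_filter; apply: cF; rewrite /= in_itv/= lexx ler01.
  - by move=> t t01; rewrite derive1E.
have mD : measurable_fun (`[0, 1]%classic : set R) ('D_1 (phi \o c)).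
  by apply: measurable_realfun.subspace_continuous_measurable_fun => //; exact: measurable_itv.
have mDE := (measurable_EFinP _ _).2 mD.
have := le_abse_integral lebesgue_measure (measurable_itv _) mDE.
rewrite /comp FTC -EFinB abse_EFin => absD.
rewrite EFinM lee_pdivrMl// (le_trans absD)//.
(* [speed] switches charts along the arc and its measurability is not established, hence the
   comparison that does without it. *)
have absD' : (\int[@lebesgue_measure R]_(x in `[0%R, 1%R])
    ((K^-1)%:E * `|('D_1 (phi \o c) x)%:E|) <= arc_length c)%E.
  apply: ge0_le_integral_nonmeas => t t01.
    by rewrite mule_ge0// lee_fin invr_ge0 ltW.
  rewrite /= -EFinM lee_fin mulrC ler_pdivrMr// mulrC.
  by have [] := along _ t01.
rewrite -lee_pdivrMl// -ge0_integralZl//.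
- by apply: measurableT_comp.
- by rewrite lee_fin invr_ge0 ltW.
Qed.

Lemma C1_lipschitz_path K (phi : M -> R) (s : seq (R -> M)) x y : 0 < K ->
  C1_lipschitz K phi -> joins x s y ->
  ((K^-1 * `|phi x - phi y|)%:E <= \sum_(c <- s) arc_length c)%E.
Proof.
move=> K0 Lphi; elim: s x => [x /= ->|c s IH x /= [Cc <- /IH h]].
  by rewrite big_nil subrr normr0 mulr0.
rewrite big_cons; apply: le_trans (leeD (C1_lipschitz_arc K0 Lphi Cc) h).
rewrite -EFinD lee_fin -mulrDr ler_wpM2l ?invr_ge0 ?(ltW K0)//.
by rewrite (distrC (phi (c 1)) (phi (c 0))) ler_distD.
Qed.

Lemma rdist_ge0 (x y : M) : (0 <= rdist x y)%E.
Proof.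
apply/le_ereal_inf_tmp => _ [s _ <-]; apply: sume_ge0 => c _.
exact: arc_length_ge0.
Qed.

(** Restricted to finite distances, since [fine] sends the infinite distance to 0. *)
Definition rlipschitz (K : R) (phi : M -> R) := forall x y,
  (rdist x y < +oo)%E -> `|phi x - phi y| <= K * fine (rdist x y).

Lemma C1_lipschitz_rlipschitz K (phi : M -> R) : 0 < K ->
  C1_lipschitz K phi -> rlipschitz K phi.
Proof.
move=> K0 Lphi x y xy.
have : ((K^-1 * `|phi x - phi y|)%:E <= rdist x y)%E.
  by apply/le_ereal_inf_tmp => _ [s js <-]; exact: C1_lipschitz_path js.
rewrite -(@fineK _ (rdist x y)) ?ge0_fin_numE ?rdist_ge0//.
by rewrite lee_fin ler_pdivrMl.
Qed.
End gradient.

(** * Bump functions supported in a chart *)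

Section bump.
Context {R : realType} {d : nat} (M : closedRiemannianManifold R d).

Definition chart_ext (i : chart_index M) (b : 'rV[R]_d -> R) (y : M) : R :=
  if pselect (chart_dom i y) then b (chart i y) else 0.

Lemma chart_extE i b y : chart_dom i y -> chart_ext i b y = b (chart i y).
Proof. by rewrite /chart_ext; case: pselect. Qed.

(** The sum of the absolute partial derivatives is continuous and dominates all directional
    derivatives. *)
Lemma derive_bound (b : 'rV[R]_d -> R) (B : set 'rV[R]_d) : compact B ->
  (forall v, C1_at b v) ->
  exists2 L, 0 < L & forall v u, B v -> `|'D_u b v| <= L * `|u|.
Proof.
move=> cB Cb; pose S v := \sum_j `|'D_('e_j) b v|.
have bS v u : `|'D_u b v| <= S v * `|u|.
  rewrite derive_rV; last exact: C1_at_differentiable.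
  rewrite (le_trans (ler_norm_sum _ _ _))// mulr_suml; apply: ler_sum => j _.
  by rewrite normrM mulrC ler_wpM2l// ler_coord_norm.
have S0 v : 0 <= S v by apply: sumr_ge0.
have cS : continuous S.
  move=> v; apply: continuous_sum_at => j.
  have [_ /(_ 'e_j) cD] := Cb v.
  exact: (@continuous_comp _ _ _ ('D_('e_j) b) (fun x => `|x|) v cD
           (@norm_continuous _ _ _)).
have [B0|B0] := pselect (B !=set0); last first.
  by exists 1 => // v u Bv; exfalso; apply: B0; exists v.
have [v0 _ v0max] := compact_EVT_max B0 cB (continuous_subspaceT cS).
exists (S v0 + 1); first by rewrite ltr_wpDl.
move=> v u Bv; rewrite (le_trans (bS v u))// ler_wpM2r//.
by rewrite (le_trans (v0max _ (mem_set Bv)))// lerDl.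
Qed.

(** [r] is chosen before [b], so one ball serves several functions. On it the metric dominates a
    multiple of the coordinate norm, which turns a coordinate derivative bound into a Riemannian
    one. Hausdorffness makes the compact support closed, so the extension by 0 stays C^1 at the edge
    of the chart. *)
Lemma chart_ext_C1_lipschitz (i : chart_index M) (x0 : M) : chart_dom i x0 ->
  exists2 r, 0 < r & forall b : 'rV[R]_d -> R, (forall v, C1_at b v) ->
    (forall v, r < `|chart i x0 - v| -> b v = 0) ->
    exists2 K, 0 < K & C1_lipschitz K (chart_ext i b).
Proof.
move=> ix0; set v0 := chart i x0.
have v0im : (chart i @` chart_dom i) v0 by exists x0.
have [|l l0 hl] := @quad_locally_coercive _ _ (metric i) v0 _
    (fun u => @metric_pos _ _ M i v0 u v0im).
  exact: (metric_smooth i 0).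
have : \forall v \near v0, (chart i @` chart_dom i) v /\
    forall u, l * `|u| ^+ 2 <= quad (metric i v) u.
  by apply: filterI => //; exact: nbhs_chart_image.
move=> /nbhs_ballP[e /= e0 ehl].
(* Half of [e], so that the closed ball of radius [r] stays inside the ball where the metric is
   controlled. *)
pose r := e / 2; have r0 : 0 < r by rewrite divr_gt0.
pose B := [set v | `|v0 - v| <= r].
have Be v : B v -> ball v0 e v.
  rewrite /B/= -ball_normE/= => /le_lt_trans; apply.
  by rewrite /r ltr_pdivrMr// ltr_pMr// ltr1n.
have cB : compact B.
  apply: (@closed_bounded_rV_compact _ _ _ (`|v0| + r)).
    exact: (@closed_closed_ball_ _ _ v0 r).
  move=> u /= uB; rewrite -(subKr v0 u) (le_trans (ler_normB _ _))// lerD2l.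
  exact: uB.
exists r => // b Cb b0.
have [L L0 bL] := derive_bound cB Cb.
pose K := L / Num.sqrt l.
have sl0 : 0 < Num.sqrt l by rewrite sqrtr_gt0.
have K0 : 0 < K by rewrite divr_gt0.
exists K => //.
pose supp : set M := chart_inv i @` B.
have clS : closed supp.
  apply: compact_closed; first exact: carrier_hausdorff.
  apply: continuous_compact => //; apply: continuous_in_subspaceT => v.
  rewrite inE => /Be /ehl[[y iy <-] _]; exact: chart_inv_continuous.
have supp_dom : supp `<=` chart_dom i.
  by move=> _ [v /Be /ehl[[y iy <-] _] <-]; rewrite chartK.
have ext0 y : ~ supp y -> chart_ext i b y = 0.
  rewrite /chart_ext; case: pselect => // iy nsy.
  apply: b0; rewrite ltNge; apply/negP => By; apply: nsy.
  by exists (chart i y) => //; rewrite chartK.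
(* Outside the domain of the chart [i], the extension vanishes on a whole neighbourhood, the
   complement of [supp]. *)
move=> j x jx; have [ix|nix] := pselect (chart_dom i x); last first.
  have E : \forall w \near chart j x, cst 0 w =
      (chart_ext i b \o chart_inv j) w.
    apply: (@chart_inv_near _ _ M j x [set y | 0 = chart_ext i b y]) => //.
    have : nbhs x (~` supp).
      apply: open_nbhs_nbhs; split; first exact: closed_openC.
      by move=> /supp_dom.
    by apply: filterS => y /ext0 /= h; rewrite /= h.
  split; first exact: C1_at_near_eq E (C1_at_cst _ _).
  move=> u; rewrite -(near_eq_derive u E) derive_cst normr0.
  by rewrite mulr_ge0 ?sqrtr_ge0 ?ltW.
pose T := chart i \o @chart_inv _ _ M j.
have Tx : T (chart j x) = chart i x by rewrite /T/= chartK.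
have E : \forall w \near chart j x, (b \o T) w = (chart_ext i b \o chart_inv j) w.
  apply: (@chart_inv_near _ _ M j x
    [set y | b (chart i y) = chart_ext i b y]) => //.
  by apply: filterS (nbhs_chart_dom ix) => y iy; rewrite /= chart_extE.
have CT : C1_at T (chart j x).
  apply: Ck1_at (transition_smooth (c := M) j i 1) _.
  have nx := nbhs_chart_image jx.
  have ni := chart_inv_near jx (nbhs_chart_dom ix).
  apply: filterS2 nx ni => _ [y jy <-]; rewrite chartK// => iy.
  by exists y.
split; first by apply: C1_at_near_eq E _; apply: C1_at_comp.
move=> u; rewrite -(near_eq_derive u E) derive_comp; last 2 first.
- exact: C1_at_differentiable.
- exact: C1_at_differentiable.
rewrite Tx; set u' := 'D_u T (chart j x).
(* Off the closed ball [b] vanishes near the point, so the derivative is 0; on the ball [L] and [l]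
   apply. *)
have [Bx|/negP nBx] := boolP (`|v0 - chart i x| <= r); last first.
  have nz : \forall v \near chart i x, cst 0 v = b v.
    have : \forall v \near chart i x, r < `|v0 - v|.
      have cn : {for chart i x, continuous (fun v : 'rV[R]_d => `|v0 - v|)}.
        apply: (@continuous_comp _ _ _ (fun v : 'rV[R]_d => v0 - v) (fun x : 'rV[R]_d => `|x|)).
          by apply: continuousB => //; exact: cst_continuous.
        exact: norm_continuous.
      by apply: (cn [set z | r < z]); apply: lt_nbhsr; rewrite ltNge; apply/negP.
    by apply: filterS => v /b0 ->.
  rewrite -(near_eq_derive u' nz) derive_cst normr0.
  by rewrite mulr_ge0 ?sqrtr_ge0 ?ltW.
(* The Riemannian length does not depend on the chart; the estimate moves to the chart [i], where
   coercivity is known. *)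
have -> : quad (metric j (chart j x)) u = quad (metric i (chart i x)) u'.
  rewrite /u' deriveEjacobian; last exact: C1_at_differentiable.
  by rewrite (metric_transition jx ix) /quad trmx_mul !mulmxA.
rewrite (le_trans (bL _ _ Bx))// /K -mulrA ler_wpM2l ?(ltW L0)//.
rewrite mulrC ler_pdivlMr// mulrC -(normr_id u') -sqrtr_sqr -sqrtrM ?(ltW l0)//.
rewrite ler_wsqrtr//.
have [_ /(_ u')] : (chart i @` chart_dom i) (chart i x) /\
    forall u, l * `|u| ^+ 2 <= quad (metric i (chart i x)) u by exact/ehl/Be.
by [].
Qed.
End bump.

(** * Finitely many functions of bounded gradient that separate points *)

Section separation.
Context {R : realType} {d : nat} (M : closedRiemannianManifold R d).

Lemma chart_ext_out (i : chart_index M) (b : 'rV[R]_d -> R) y :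
  ~ chart_dom i y -> chart_ext i b y = 0.
Proof. by move=> niy; rewrite /chart_ext; case: pselect. Qed.

(** The functions are a bump and its products with the coordinates: where the bump is positive, its
    common value can be divided out, which recovers the coordinates. *)
Lemma local_separation (x0 : M) : exists phi : option 'I_d -> M -> R,
  [/\ forall k, exists2 K, 0 < K & C1_lipschitz K (phi k),
      0 < phi None x0 &
      forall y z, 0 < phi None y -> (forall k, phi k y = phi k z) -> y = z].
Proof.
pose i := chart_at x0; have ix0 : chart_dom i x0 := chart_atP x0.
have [r r0 hr] := chart_ext_C1_lipschitz ix0.
set v0 := chart i x0 in hr.
pose q (v : 'rV[R]_d) := r ^+ 2 - \sum_j (v 0 j - v0 0 j) ^+ 2.
pose b v := sqpos (q v).
pose c k (v : 'rV[R]_d) : R := if k is Some j then b v * v 0 j else b v.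
have Cb v : C1_at b v.
  apply: (@C1_at_compR _ _ _ q); last exact: C1_at_sqpos.
  have Cs : C1_at (\sum_j (fun v : 'rV[R]_d => (v 0 j - v0 0 j) ^+ 2)) v.
    elim/big_ind : _ => [|f g|j _]; [exact: C1_at_cst|exact: C1_atD|].
    have Cj : C1_at ((fun v : 'rV[R]_d => v 0 j) + cst (- v0 0 j)) v.
      by apply: C1_atD; [exact: C1_at_coord|exact: C1_at_cst].
    exact: (C1_atM Cj Cj).
  have := C1_atD (C1_at_cst (r ^+ 2 : R) v) (C1_atM (C1_at_cst (-1 : R) v) Cs).
  apply: C1_at_near_eq; near=> w.
  by rewrite /q !fctE/= /cst mulN1r fct_sumE.
have b0 v : r < `|v0 - v| -> b v = 0.
  move=> rv; rewrite /b /sqpos max_r ?expr0n//.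
  (* The norm of row vectors is the sup norm: one coordinate alone exceeds [r], which already makes
     [q v] nonpositive. *)
  have [[? j] /= vj] : exists ij, `|v0 - v| = `|(v0 - v) ij.1 ij.2|.
    by apply: mx_norm_neq0; rewrite gt_eqF// (lt_trans r0).
  rewrite subr_le0 (bigD1 j)//= ler_wpDr//.
    by apply: sumr_ge0 => k _; exact: sqr_ge0.
  rewrite -[leRHS]real_normK ?num_real// ler_sqr ?nnegrE ?(ltW r0)//.
  by move: rv; rewrite vj !mxE ord1 distrC => /ltW.
exists (fun k => chart_ext i (c k)); split.
- move=> k; apply: hr.
    by case: k => [j|] v //=; apply: C1_atM => //; exact: C1_at_coord.
  by case: k => [j|] v /b0 //= ->; rewrite mul0r.
- rewrite chart_extE//= /b /sqpos/= exprn_gt0// lt_max; apply/orP; left.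
  rewrite /q big1 ?subr0 ?exprn_gt0// => j _.
  by rewrite subrr expr0n.
- move=> y z y0 yz.
  have dom w : 0 < chart_ext i (c None) w -> chart_dom i w.
    have [//|nw] := pselect (chart_dom i w).
    by rewrite (chart_ext_out _ nw) ltxx.
  have iy := dom _ y0; have iz : chart_dom i z by apply: dom; rewrite -yz.
  rewrite -(chartK iy) -(chartK iz); congr chart_inv; apply/rowP => j.
  have := yz (Some j); have := yz None; move: y0; rewrite !chart_extE//=.
  by move=> by0 <- /mulfI; apply; rewrite gt_eqF.
Unshelve. all: by end_near. Qed.

Lemma C1_lipschitz_separation : exists (I : finType) (phi : I -> M -> R),
  (forall i, exists2 K, 0 < K & C1_lipschitz K (phi i)) /\
  forall y z, (forall i, phi i y = phi i z) -> y = z.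
Proof.
have [F hF] := choice local_separation.
have [||s hs] := compact_open_seq (@carrier_compact _ _ M)
    (U := fun x => [set y | 0 < F x None y]).
- move=> x; have [/(_ None)[K _ /C1_lipschitz_continuous cF] _ _] := hF x.
  by apply: (@open_comp _ _ (F x None) [set t | 0 < t]) => //; exact: open_gt.
- by move=> x; have [] := hF x.
exists (seq_sub s * option 'I_d)%type, (fun i => F (val i.1) i.2); split.
  by move=> [x k] /=; have [/(_ k)] := hF (val x).
move=> y z yz; have [x xs xy] := hs y.
have [_ _ /(_ y z xy)] := hF x; apply=> k.
exact: (yz (SeqSub xs, k)).
Qed.
End separation.

(** * Lipschitz functions are Hoelder *)

Section hoelder.
Context {R : realType} {d : nat} (M : closedRiemannianManifold R d).

Definition rlip (g : M -> R) := exists2 K, 0 <= K & rlipschitz K g.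

Lemma rlip_cst a : rlip (cst a).
Proof. by exists 0 => // x y _; rewrite subrr normr0 mul0r. Qed.

Lemma rlip_affine a b g : rlip g -> rlip (fun x => a + b * g x).
Proof.
case=> K K0 Kg; exists (`|b| * K); first by rewrite mulr_ge0.
move=> x y xy; rewrite opprD addrACA subrr add0r -mulrBr normrM -mulrA.
by rewrite ler_wpM2l// Kg.
Qed.

Lemma rlip_max g h : rlip g -> rlip h -> rlip (fun x => Num.max (g x) (h x)).
Proof.
move=> [K K0 Kg] [L L0 Lh]; exists (K + L); first exact: addr_ge0.
move=> x y xy; have D0 := fine_ge0 (rdist_ge0 x y).
have := Kg _ _ xy; have := Lh _ _ xy.
have := mulr_ge0 K0 D0; have := mulr_ge0 L0 D0; rewrite mulrDl.
rewrite !ler_norml => ? ? /andP[? ?] /andP[? ?].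
by case: (leP (g x) (h x)) => ?; case: (leP (g y) (h y)) => ?; apply/andP; split; lra.
Qed.

Lemma rlip_min g h : rlip g -> rlip h -> rlip (fun x => Num.min (g x) (h x)).
Proof.
move=> [K K0 Kg] [L L0 Lh]; exists (K + L); first exact: addr_ge0.
move=> x y xy; have D0 := fine_ge0 (rdist_ge0 x y).
have := Kg _ _ xy; have := Lh _ _ xy.
have := mulr_ge0 K0 D0; have := mulr_ge0 L0 D0; rewrite mulrDl.
rewrite !ler_norml => ? ? /andP[? ?] /andP[? ?].
by case: (leP (g x) (h x)) => ?; case: (leP (g y) (h y)) => ?; apply/andP; split; lra.
Qed.

(** At distance D at most 1, the Lipschitz bound suffices because D <= D^a; at larger distance, the
    oscillation is at most 2B and D^a >= 1. *)
Lemma rlip_hoelder_space (a B : R) (g : M -> R) : 0 < a <= 1 ->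
  rlip g -> (forall x, `|g x| <= B) -> hoelder_space a g.
Proof.
move=> /andP[a0 a1] [K K0 Kg] gB; rewrite /hoelder_space/= /hoelder_norm.
have B0 : 0 <= B := le_trans (normr_ge0 _) (gB point).
apply: (@le_lt_trans _ _ (B%:E + (K + B *+ 2)%:E)%E); last first.
  by rewrite -EFinD ltry.
apply: leeD; first by apply: ge_ereal_sup => _ [x _ <-]; rewrite lee_fin.
apply: ge_ereal_sup => _ [[x y] /= xy <-]; rewrite lee_fin.
set D := fine (rdist x y); have D0 : 0 <= D := fine_ge0 (rdist_ge0 x y).
have KB : 0 <= K + B *+ 2 by rewrite addr_ge0// mulrn_wge0.
have := Kg x y xy; rewrite -/D => gK.
(* At distance 0 the quotient is 0 by the convention on division by 0. *)
have [DE|Dn0] := eqVneq D 0.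
  by rewrite DE powR0 ?gt_eqF// invr0 mulr0.
have {Dn0} Dp : 0 < D by rewrite lt_neqAle eq_sym Dn0.
rewrite ler_pdivrMr ?powR_gt0//.
have [D1|/ltW D1] := leP D 1.
  apply: le_trans gK _; apply: ler_pM => //; first by rewrite lerDl mulrn_wge0.
  by rewrite ger1_powR// Dp.
have Da : 1 <= D `^ a by rewrite -(powRr0 D) ler_powR// ltW.
rewrite -[leLHS]mulr1; apply: ler_pM => //.
rewrite (le_trans (ler_normB _ _))//.
by have := gB x; have := gB y; rewrite mulr2n; lra.
Qed.
End hoelder.

(** * Integrals of continuous functions *)

Section continuous_integral.
Context {R : realType} {T : ptopologicalType}.
Hypothesis cT : compact [set: T].
Implicit Types (f g : T -> R) (P : probability (borel T) R).

Lemma open_borel (A : set T) : open A -> measurable (A : set (borel T)).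
Proof. exact: sub_sigma_algebra. Qed.

Lemma continuous_borel_measurable f : continuous f ->
  measurable_fun [set: borel T] (f : borel T -> R).
Proof.
move=> cf; apply: (measurability _ (RGenOpens.measurableE R)).
move=> _ [_ [a [b [-> <-]]]]; rewrite setTI; apply: open_borel.
by apply: open_comp => // x _; exact: cf.
Qed.

Lemma continuous_abs f : continuous f -> continuous (fun x => `|f x|).
Proof.
move=> cf x; apply: (@continuous_comp _ _ _ f (fun t : R => `|t|)); first exact: cf.
exact: norm_continuous.
Qed.

Lemma compact_continuous_bounded f : continuous f ->
  exists2 B, 0 < B & forall x, `|f x| <= B.
Proof.
move=> cf; have cn := continuous_abs cf.
have T0 : [set: T] !=set0 by exists point.
have [x0 _ x0max] := compact_EVT_max T0 cT (continuous_subspaceT cn).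
exists (`|f x0| + 1); first by rewrite ltr_wpDl.
by move=> x; rewrite (le_trans (x0max x _)) ?inE// lerDl.
Qed.

Lemma continuous_integrable P f : continuous f ->
  P.-integrable [set: borel T] (EFin \o f).
Proof.
move=> cf; apply: measurable_bounded_integrable => //.
- by rewrite (@le_lt_trans _ _ 1%E) ?probability_le1 ?ltry.
- exact: continuous_borel_measurable.
- have [B B0 fB] := compact_continuous_bounded cf.
  exists B; split; first exact: num_real.
  by move=> x Bx y _ /=; rewrite (le_trans (fB y))// ltW.
Qed.

Lemma cInt_cst P (a : R) : \int[P]_x a = a.
Proof.
have -> : \int[P]_x a = a * fine (P [set: borel T]) by exact: Rintegral_cst.
by rewrite [X in fine X](_ : _ = 1%E) ?mulr1//; exact: probability_setT.
Qed.

Lemma cIntD P f g : continuous f -> continuous g ->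
  \int[P]_x (f x + g x) = \int[P]_x f x + \int[P]_x g x.
Proof. by move=> cf cg; rewrite RintegralD//; exact: continuous_integrable. Qed.

Lemma cIntB P f g : continuous f -> continuous g ->
  \int[P]_x (f x - g x) = \int[P]_x f x - \int[P]_x g x.
Proof. by move=> cf cg; rewrite RintegralB//; exact: continuous_integrable. Qed.

Lemma cIntZ P a f : continuous f -> \int[P]_x (a * f x) = a * \int[P]_x f x.
Proof. by move=> cf; rewrite RintegralZl//; exact: continuous_integrable. Qed.

Lemma cInt_le P f g : continuous f -> continuous g -> (forall x, f x <= g x) ->
  \int[P]_x f x <= \int[P]_x g x.
Proof. by move=> cf cg fg; apply: le_Rintegral => //; exact: continuous_integrable. Qed.

Lemma cInt_norm P f : continuous f ->
  `|\int[P]_x f x| <= \int[P]_x `|f x|.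
Proof. by move=> cf; apply: le_normr_Rintegral => //; exact: continuous_integrable. Qed.

Lemma continuous_sum n (f : nat -> T -> R) : (forall j, continuous (f j)) ->
  continuous (fun x => \sum_(j < n) f j x).
Proof.
move=> cf x; rewrite /continuous_at.
by apply: cvg_big => [|i _]; [exact: add_continuous|exact: cf].
Qed.

Lemma cInt_sum P n (f : nat -> T -> R) : (forall j, continuous (f j)) ->
  \int[P]_x (\sum_(j < n) f j x) = \sum_(j < n) \int[P]_x f j x.
Proof.
move=> cf; elim: n => [|n IH].
  rewrite big_ord0 -[RHS](cInt_cst P); congr (Rintegral _ _ _).
  by apply/funext => x; rewrite big_ord0.
rewrite big_ord_recr/= -IH -cIntD//; last exact: continuous_sum.
congr (Rintegral _ _ _).
by apply/funext => x; rewrite big_ord_recr.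
Qed.

(** The form in which exceptional sets enter: a pointwise inequality that may fail by [B] on [A]. A
    negative [B] yields Markov's inequality. *)
Lemma cInt_le_indic P f g (B : R) (A : set (borel T)) : continuous f ->
  continuous g -> measurable A -> (forall x, f x <= g x + B * \1_A x) ->
  \int[P]_x f x <= \int[P]_x g x + B * fine (P A).
Proof.
move=> cf cg mA fgA.
have iA : P.-integrable [set: borel T] (EFin \o (\1_A : borel T -> R)).
  apply: measurable_bounded_integrable => //.
  - by rewrite (@le_lt_trans _ _ 1%E) ?probability_le1 ?ltry.
  - exists 1; split; first exact: num_real.
    move=> x x1 y _ /=; rewrite (le_trans _ (ltW x1))// indicE.
    by case: (_ \in _); rewrite ?normr0 ?normr1 ?ler01.
have iAB : P.-integrable [set: borel T] (EFin \o (fun x => B * \1_A x)).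
  have := integrableZl measurableT B iA.
  by apply: eq_integrable.
have -> : B * fine (P A) = \int[P]_x (B * \1_A x).
  by rewrite RintegralZl// /Rintegral integral_indic// setIT.
rewrite -RintegralD//; last exact: continuous_integrable.
apply: le_Rintegral => //; first exact: continuous_integrable.
have := integrableD measurableT (continuous_integrable P cg) iAB.
by apply: eq_integrable.
Qed.

Lemma cInt_invariant P (F : T -> T) g : continuous F -> continuous g ->
  (forall A : set (borel T), measurable A -> P (F @^-1` A) = P A) ->
  \int[P]_x g (F x) = \int[P]_x g x.
Proof.
move=> cF cg PF.
have mF : measurable_fun [set: borel T] (F : borel T -> borel T).
  apply: (@measurability _ _ (borel T) (borel T) setT F (@open T)) => //.
  move=> _ [A oA <-]; rewrite setTI; apply: open_borel.
  by apply: open_comp => // x _; exact: cF.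
have cgF : continuous (g \o F).
  by move=> x; apply: continuous_comp; [exact: cF|exact: cg].
pose F' : {mfun borel T >-> borel T} := mfun_Sub (mem_set mF).
have -> : \int[P]_x g x = fine (\int[pushforward P F']_x (g x)%:E).
  congr fine; apply: eq_measure_integral => A mA _.
  by rewrite /= /pushforward PF.
rewrite integral_pushforward//.
- by apply/measurable_EFinP; exact: continuous_borel_measurable.
- by rewrite preimage_setT; exact: (continuous_integrable P cgF).
Qed.

Lemma decreasing_measure_small P (A : nat -> set (borel T)) (e : R) :
  (forall n, measurable (A n)) ->
  {homo A : n m / (n <= m)%N >-> (m <= n)%O} ->
  P (\bigcap_n A n) = 0%E -> 0 < e -> exists n, fine (P (A n)) < e.
Proof.
move=> mA Adec A0 e0.
have : (P \o A) x @[x --> \oo] --> P (\bigcap_n A n).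
  apply: nonincreasing_cvg_mu => //; last exact: bigcap_measurable.
  by rewrite (le_lt_trans (probability_le1 _ _))// ltry.
rewrite A0 => /fine_cvgP[_ /cvgrPdist_lt/(_ _ e0)[n _ /(_ n (leqnn n))]].
rewrite /= sub0r normrN => h; exists n; apply: le_lt_trans h.
exact: ler_norm.
Qed.
End continuous_integral.

(** * The mean ergodic theorem *)

Section ergodic.
Context {R : realType} {T : ptopologicalType}.
Hypothesis cT : compact [set: T].
Variable F : T -> T.
Hypothesis cF : continuous F.
Implicit Types (f g h : T -> R).

Definition bsum h (n : nat) (x : T) : R := \sum_(j < n) h (iter j F x).

Lemma iter_continuous n : continuous (iter n F).
Proof.
elim: n => [|n IH] x; first exact: cvg_id.
by apply: (@continuous_comp _ _ _ (iter n F) F); [exact: IH|exact: cF].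
Qed.

Lemma comp_iter_continuous h n : continuous h -> continuous (fun x => h (iter n F x)).
Proof.
move=> ch x; apply: (@continuous_comp _ _ _ (iter n F) h); last exact: ch.
exact: iter_continuous.
Qed.

Lemma bsum_continuous h n : continuous h -> continuous (bsum h n).
Proof.
move=> ch; apply: (@continuous_sum _ _ _ (fun j x => h (iter j F x))) => j.
exact: comp_iter_continuous.
Qed.

Lemma bsum0 h x : bsum h 0 x = 0.
Proof. by rewrite /bsum big_ord0. Qed.

Lemma bsumS h n x : bsum h n.+1 x = h x + bsum h n (F x).
Proof.
rewrite /bsum big_ord_recl/=; congr (_ + _); apply: eq_bigr => j _.
by rewrite -iterSr.
Qed.

Lemma bsum_bound h B n x : (forall x, `|h x| <= B) -> `|bsum h n x| <= n%:R * B.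
Proof.
move=> hB; rewrite /bsum (le_trans (ler_norm_sum _ _ _))//.
by rewrite mulr_natl -[n in leRHS]card_ord -sumr_const; apply: ler_sum.
Qed.

(* The running maximum of the Birkhoff sums of order at most n, in the recursive
   form used in Garsia's proof of the maximal ergodic theorem. *)
Fixpoint maxbsum h (n : nat) (x : T) : R :=
  if n is n'.+1 then Num.max 0 (h x + maxbsum h n' (F x)) else 0.

Lemma maxbsum_continuous h n : continuous h -> continuous (maxbsum h n).
Proof.
move=> ch; elim: n => [|n IH]; first exact: cst_continuous.
move=> x; apply: (@continuous_max _ _ (cst 0) (fun x => h x + maxbsum h n (F x))).
  exact: cst_continuous.
apply: (@continuousD _ _ _ h (maxbsum h n \o F)); first exact: ch.
by apply: continuous_comp; [exact: cF|exact: IH].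
Qed.

Lemma maxbsum_ge0 h n x : 0 <= maxbsum h n x.
Proof. by case: n => [|n] //=; rewrite le_max lexx. Qed.

Lemma maxbsum_le h n x : maxbsum h n x <= maxbsum h n.+1 x.
Proof.
elim: n x => [|n IH] x; first by rewrite [leLHS]/= maxbsum_ge0.
rewrite [leLHS]/= [leRHS]/= ge_max le_max lexx/= le_max; apply/orP; right.
by rewrite lerD2l; exact: IH.
Qed.

Lemma bsum_le_maxbsum h n x : bsum h n x <= maxbsum h n x.
Proof.
elim: n x => [|n IH] x; first by rewrite bsum0.
by rewrite bsumS/= le_max; apply/orP; right; rewrite lerD2l.
Qed.

Definition bsum_exceeds h (c : R) : set (borel T) :=
  [set x | exists n, c < bsum h n x].

Lemma bsum_exceeds_measurable h c : continuous h -> measurable (bsum_exceeds h c).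
Proof.
move=> ch; rewrite (_ : bsum_exceeds h c = \bigcup_n [set x | c < bsum h n x]).
  apply: bigcup_measurable => n _; apply: open_borel.
  by apply: (@open_comp _ _ (bsum h n) [set t | c < t]) => // x _; exact: bsum_continuous.
by apply/seteqP; split => x [n]; exists n.
Qed.

Variable mu : probability (borel T) R.
Hypothesis inv : forall A : set (borel T), measurable A -> mu (F @^-1` A) = mu A.
Hypothesis erg : forall A : set (borel T), measurable A -> F @^-1` A = A ->
  mu A = 0%E \/ mu A = 1%E.

(** Where M = [maxbsum h n] is positive, it is at most h + M o F, by monotonicity in [n]; so M - M o
    F <= h there, and invariance makes the left side integrate to 0. The remaining set shrinks to a
    null set as [n] grows. *)
Lemma maximal_ergodic h : continuous h ->
  mu (bsum_exceeds h 0) = 1%E -> 0 <= \int[mu]_x h x.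
Proof.
move=> ch h1.
have [B B0 hB] := compact_continuous_bounded cT ch.
have cm n := @maxbsum_continuous h n ch.
have cmF n : continuous (maxbsum h n \o F).
  by move=> x; apply: continuous_comp; [exact: cF|exact: cm].
pose A n : set (borel T) := [set x | ~ 0 < maxbsum h n x].
have mA n : measurable (A n).
  have -> : A n = ~` [set x | 0 < maxbsum h n x] by [].
  apply: measurableC; apply: open_borel.
  by apply: (@open_comp _ _ (maxbsum h n) [set t | 0 < t]) => // x _; exact: cm.
(* On [A n] the maximum is 0 and h + B >= 0, so the inequality fails by at most [B] there. *)
have step n : 0 <= \int[mu]_x h x + B * fine (mu (A n)).
  rewrite (@le_trans _ _ (\int[mu]_x (maxbsum h n x - maxbsum h n (F x))))//.
    rewrite (cIntB cT _ (cm n) (cmF n)) (cInt_invariant cT cF (cm n) inv).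
    by rewrite subrr.
  apply: cInt_le_indic => //.
    by move=> x; apply: (continuousB (cm n x) (cmF n x)).
  move=> x; have := hB x; rewrite ler_norml => /andP[hB1 hB2].
  rewrite indicE; case: (boolP (x \in A n)) => [|/negP].
    rewrite inE /A/= => /negP; rewrite -leNgt => m0.
    have := maxbsum_ge0 h n (F x); rewrite mulr1; lra.
  rewrite inE /A/= => /contrapT; rewrite mulr0 addr0.
  case: n => [|n]; first by rewrite /= ltxx.
  have := maxbsum_le h n (F x).
  rewrite [maxbsum _ n.+1 x]/=; set u := maxbsum _ n.+1 _; set v := maxbsum _ n _.
  by rewrite lt_max ltxx/= => vu /[dup] /ltW /max_idPr ->; lra.
have A0 : mu (\bigcap_n A n) = 0%E.
  have mE := bsum_exceeds_measurable 0 ch.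
  apply: (@subset_measure0 _ _ _ mu _ (~` bsum_exceeds h 0)).
  - exact: bigcap_measurable.
  - exact: measurableC.
  - move=> x Ax [n]; apply/negP; rewrite -leNgt.
    rewrite (le_trans (bsum_le_maxbsum h n x))// leNgt; apply/negP.
    exact: (Ax n).
  - by apply: etrans (probability_setC mu mE) _; rewrite h1 subee.
rewrite leNgt; apply/negP => hlt0.
have e0 : 0 < (- (\int[mu]_x h x)) / B by rewrite divr_gt0// oppr_gt0.
have [|n] := decreasing_measure_small mA _ A0 e0.
  move=> p q pq; apply/subsetPset => x; rewrite /A/=; apply: contra_not.
  move=> /lt_le_trans; apply.
  elim: q pq => [|q IH]; first by rewrite leqn0 => /eqP ->.
  rewrite leq_eqVlt => /predU1P[->//|]; rewrite ltnS => /IH /le_trans; apply.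
  exact: maxbsum_le.
rewrite ltr_pdivlMr// => h2; have := step n; lra.
Qed.

(* The set where the Birkhoff sums are unbounded above is exactly invariant, so
   it is null: otherwise the maximal ergodic theorem contradicts int h < 0. *)
Lemma bsum_unbounded_null h : continuous h -> \int[mu]_x h x < 0 ->
  mu (\bigcap_(K : nat) bsum_exceeds h K%:R) = 0%E.
Proof.
move=> ch hlt0; set E := \bigcap_K _.
have mK (K : nat) := bsum_exceeds_measurable K%:R ch.
have mE : measurable (E : set (borel T)) by exact: bigcap_measurable.
have nat_ge (r : R) : exists N : nat, r <= N%:R.
  by exists (Num.bound `|r|); rewrite (le_trans (ler_norm r))// ltW// archi_boundP.
(* One step of the orbit shifts the threshold by [h x]; since [E] involves all thresholds, the
   invariance is exact, as [erg] demands. *)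
have EF : F @^-1` E = E.
  apply/seteqP; split => x Ex K _ /=.
    have [N hN] := nat_ge (K%:R - h x); have [n /= nN] := Ex N Logic.I.
    by exists n.+1; rewrite bsumS; lra.
  have [N hN] := nat_ge (K%:R + h x); have [[|n] /=] := Ex N Logic.I.
    by rewrite bsum0 ltNge ler0n.
  by rewrite bsumS => nN; exists n; lra.
have [//|E1] := erg mE EF; exfalso.
suff /(maximal_ergodic ch) : mu (bsum_exceeds h 0) = 1%E.
  by rewrite leNgt hlt0.
apply/eqP; rewrite eq_le probability_le1//=; last exact: (mK 0%N).
rewrite -E1; apply: le_measure; rewrite ?inE//; first exact: (mK 0%N).
by move=> x /(_ 0%N Logic.I).
Qed.

(** Off a set of small measure all Birkhoff sums are at most [K], so averages are at most K/n; on
    that set they are at most [B]. *)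
Lemma positive_part_small h (e : R) : continuous h -> \int[mu]_x h x < 0 -> 0 < e ->
  exists n0, forall n, (n0 <= n)%N ->
    \int[mu]_x Num.max (n%:R^-1 * bsum h n x) 0 <= e.
Proof.
move=> ch hlt0 e0; have E0 := bsum_unbounded_null ch hlt0.
have [B B0 hB] := compact_continuous_bounded cT ch.
have eB : 0 < e / 2 / B by rewrite !divr_gt0.
have [||K hK] := decreasing_measure_small _ _ E0 eB.
- by move=> K; exact: bsum_exceeds_measurable.
- move=> p q pq; apply/subsetPset => x [n qn]; exists n.
  by apply: le_lt_trans qn; rewrite ler_nat.
exists (Num.bound (K%:R / (e / 2))).+1 => n n0n.
have n0 : 0 < n%:R :> R by rewrite ltr0n (leq_trans _ n0n).
have Kn : K%:R / n%:R <= e / 2.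
  rewrite ler_pdivrMr// mulrC -ler_pdivrMr ?divr_gt0//.
  have Ke0 : 0 <= K%:R / (e / 2) by rewrite divr_ge0// ltW// divr_gt0.
  by rewrite (le_trans (ltW (archi_boundP Ke0)))// ler_nat ltnW.
have cmax : continuous (fun x => Num.max (n%:R^-1 * bsum h n x) 0).
  move=> x; apply: (@continuous_max _ _ (fun x => n%:R^-1 * bsum h n x) (cst 0)).
    apply: (@continuousM _ _ (cst n%:R^-1) (bsum h n)).
      exact: cst_continuous.
    exact: bsum_continuous.
  exact: cst_continuous.
apply: (@le_trans _ _ (\int[mu]_x (e / 2) + B * fine (mu (bsum_exceeds h K%:R)))).
  apply: cInt_le_indic => //.
  - exact: cst_continuous.
  - exact: bsum_exceeds_measurable.
  move=> x; rewrite indicE; case: (boolP (x \in _)) => [_|/negP].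
    rewrite mulr1 ge_max; apply/andP; split; last first.
      by rewrite addr_ge0 ?divr_ge0 ?ltW.
    apply: (@le_trans _ _ B); last by rewrite lerDr divr_ge0 ?ltW.
    rewrite mulrC ler_pdivrMr// mulrC.
    exact: le_trans (ler_norm _) (bsum_bound n x hB).
  rewrite inE => hx; rewrite mulr0 addr0 ge_max; apply/andP; split; last first.
    by rewrite divr_ge0 ?ltW.
  apply: le_trans Kn; rewrite mulrC ler_wpM2r ?invr_ge0 ?ler0n//.
  by rewrite leNgt; apply/negP => nK; apply: hx; exists n.
rewrite cInt_cst; move: hK; rewrite ltr_pdivlMr// mulrC; lra.
Qed.

Lemma cInt_iter g j : continuous g -> \int[mu]_x g (iter j F x) = \int[mu]_x g x.
Proof.
move=> cg; elim: j => [//|j IH].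
rewrite -IH -[RHS](cInt_invariant cT cF _ inv)//; last exact: comp_iter_continuous.
by congr (Rintegral _ _ _); apply/funext => x; rewrite iterSr.
Qed.

Lemma cInt_bsum g n : continuous g ->
  \int[mu]_x bsum g n x = n%:R * \int[mu]_x g x.
Proof.
move=> cg; rewrite mulr_natl.
have cgi j : continuous (fun x => g (iter j F x)) by exact: comp_iter_continuous.
apply: etrans (cInt_sum cT mu n cgi) _.
rewrite (eq_bigr (fun=> \int[mu]_x g x)); last by move=> j _; exact: cInt_iter.
by rewrite sumr_const card_ord.
Qed.

Lemma bavg_continuous g n : continuous g -> continuous (fun x => n%:R^-1 * bsum g n x).
Proof.
move=> cg x; apply: (@continuousM _ _ (cst n%:R^-1) (bsum g n)).
  exact: cst_continuous.
exact: bsum_continuous.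
Qed.

(** One-sided control is enough: u = A_n g - c has integral 0 and |u| = 2 max(u, 0) - u. Subtracting
    c + e/4 from [g] makes the integral negative, as [positive_part_small] requires. *)
Lemma mean_ergodic g (e : R) : continuous g -> 0 < e ->
  exists2 n, (0 < n)%N &
    \int[mu]_x `|n%:R^-1 * bsum g n x - \int[mu]_x g x| <= e.
Proof.
move=> cg e0; set c := \int[mu]_x g x.
pose h x := g x - (c + e / 4).
have e4 : 0 < e / 4 by rewrite divr_gt0.
have cc a : continuous (cst a : T -> R) by exact: cst_continuous.
have ch : continuous h by move=> x; apply: (continuousB (cg x) (cc (c + e / 4) x)).
have hlt0 : \int[mu]_x h x < 0.
  have -> : \int[mu]_x h x = c - (c + e / 4).
    by rewrite (cIntB cT _ cg (cc _)) cInt_cst.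
  by lra.
have [n0 hn0] := positive_part_small ch hlt0 e4.
pose n := n0.+1; exists n => //.
have n_gt0 : 0 < n%:R :> R by rewrite ltr0n.
have cavg := @bavg_continuous g n cg.
have cavgc : continuous (fun x => n%:R^-1 * bsum g n x - c).
  by move=> x; apply: (continuousB (cavg x) (cc c x)).
have cm : continuous (fun x => Num.max (n%:R^-1 * bsum h n x) 0).
  move=> x; apply: (@continuous_max _ _ (fun x => n%:R^-1 * bsum h n x) (cst 0)).
    exact: bavg_continuous.
  exact: cst_continuous.
have avg0 : \int[mu]_x (n%:R^-1 * bsum g n x - c) = 0.
  rewrite (cIntB cT _ cavg (cc _)) cInt_cst cIntZ//; last exact: bsum_continuous.
  by rewrite cInt_bsum// mulKf ?subrr// gt_eqF.
have hE x : n%:R^-1 * bsum h n x = n%:R^-1 * bsum g n x - c - e / 4.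
  rewrite /bsum sumrB sumr_const card_ord -[X in _ - X]mulr_natl mulrBr mulKf ?gt_eqF//.
  by rewrite opprD addrA.
have hI := hn0 n (leqnSn _).
(* Pointwise, max(u, 0) <= max(u - e/4, 0) + e/4; the total is 2 (e/4) + e/2 = e. *)
apply: (@le_trans _ _ (\int[mu]_x
    (2 * Num.max (n%:R^-1 * bsum h n x) 0 + e / 2 - (n%:R^-1 * bsum g n x - c)))).
  apply: cInt_le => //.
  - exact: continuous_abs.
  - move=> x; apply: (continuousB _ (cavgc x)).
    apply: (continuousD _ (cc (e / 2) x)).
    exact: (continuousM (cc 2 x) (cm x)).
  - move=> x; rewrite hE; set u := _ - c; rewrite /Num.max.
    by case: ltP => ?; case: (ger0P u) => ?; lra.
have c2m : continuous (fun x => 2 * Num.max (n%:R^-1 * bsum h n x) 0).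
  by move=> x; exact: (continuousM (cc 2 x) (cm x)).
have c2me : continuous (fun x => 2 * Num.max (n%:R^-1 * bsum h n x) 0 + e / 2).
  by move=> x; exact: (continuousD (c2m x) (cc (e / 2) x)).
rewrite (cIntB cT _ c2me cavgc) avg0 subr0.
have -> : \int[mu]_x (2 * Num.max (n%:R^-1 * bsum h n x) 0 + e / 2) =
    2 * (\int[mu]_x Num.max (n%:R^-1 * bsum h n x) 0) + e / 2.
  by rewrite (cIntD cT _ c2m (cc _)) cInt_cst (cIntZ cT _ _ cm).
lra.
Qed.
End ergodic.

(** * Transfer of the mean ergodic theorem to the reference measure *)

Section transfer.
Context {R : realType} {T : ptopologicalType}.
Hypothesis cT : compact [set: T].
Variable F : T -> T.
Hypothesis cF : continuous F.
Implicit Types (f g h : T -> R).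
Local Notation bsum := (bsum F).

Lemma bsumSr g n x : bsum g n.+1 x = bsum g n x + g (iter n F x).
Proof. by rewrite /bsum big_ord_recr. Qed.

Lemma bsum_shift g B n j x : (forall x, `|g x| <= B) ->
  `|bsum g n (iter j F x) - bsum g n x| <= j%:R * (2 * B).
Proof.
move=> gB; elim: j => [|j IH]; first by rewrite subrr normr0 mul0r.
set y := iter j F x in IH *; rewrite iterS -/y.
have E : bsum g n (F y) = bsum g n y + (g (iter n F y) - g y).
  by have := bsumS F g n y; have := bsumSr g n y; lra.
rewrite E -natr1 mulrDl mul1r addrAC (le_trans (ler_normD _ _))// lerD//.
rewrite (le_trans (ler_normB _ _))//.
by have := gB (iter n F y); have := gB y; lra.
Qed.

(** After exchanging the sums, the right-hand side is the mean over j < w of the sums of [g] started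
    at F^j x; each differs from [bsum g N x] by boundary terms only. *)
Lemma bsum_window g B w N x : (0 < w)%N -> (forall x, `|g x| <= B) ->
  `|bsum g N x - \sum_(k < N) w%:R^-1 * bsum g w (iter k F x)| <= w%:R * (2 * B).
Proof.
move=> w0 gB; have w0R : 0 < w%:R :> R by rewrite ltr0n.
have -> : \sum_(k < N) w%:R^-1 * bsum g w (iter k F x) =
    w%:R^-1 * \sum_(j < w) bsum g N (iter j F x).
  rewrite -mulr_sumr /bsum exchange_big/=; congr (_ * _).
  by apply: eq_bigr => j _; apply: eq_bigr => k _; rewrite -!iterD addnC.
have -> : bsum g N x = w%:R^-1 * \sum_(j < w) bsum g N x.
  by rewrite sumr_const card_ord -[X in _ * X]mulr_natl mulKf// gt_eqF.
rewrite -mulrBr normrM ger0_norm ?invr_ge0 ?ler0n// ler_pdivrMl//.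
rewrite -sumrB (le_trans (ler_norm_sum _ _ _))//.
have -> : w%:R * (w%:R * (2 * B)) = \sum_(j < w) w%:R * (2 * B).
  by rewrite sumr_const card_ord -[RHS]mulr_natl.
apply: ler_sum => j _.
rewrite distrC (le_trans (bsum_shift _ _ _ gB))//.
by rewrite ler_wpM2r ?ler_nat ?(ltnW (ltn_ord j))// mulr_ge0// (le_trans _ (gB x)).
Qed.

Variables m mu : probability (borel T) R.
Hypothesis inv : forall A : set (borel T), measurable A -> mu (F @^-1` A) = mu A.
Hypothesis erg : forall A : set (borel T), measurable A -> F @^-1` A = A ->
  mu A = 0%E \/ mu A = 1%E.
Hypothesis ces : forall g (e : R), continuous g -> 0 < e ->
  exists N0, forall N, (N0 <= N)%N ->
    N%:R^-1 * (\sum_(k < N) \int[m]_x g (iter k F x)) <= \int[mu]_x g x + e.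

(** Three errors of e/3: the boundary error b/N of the window, the Cesaro error for the continuous
    [H] at the fixed [w], and the integral of [H] under [mu]. *)
Lemma reference_mean_ergodic g (e : R) : continuous g -> 0 < e ->
  exists N0, forall N, (N0 <= N)%N ->
    \int[m]_x `|N%:R^-1 * bsum g N x - \int[mu]_x g x| <= e.
Proof.
move=> cg e0; set c := \int[mu]_x g x.
have e3 : 0 < e / 3 by rewrite divr_gt0.
have [w w0] := mean_ergodic cT cF inv erg cg e3; rewrite -/c => hw.
have [B B0 gB] := compact_continuous_bounded cT cg.
pose H x := `|w%:R^-1 * bsum g w x - c|.
have cc a : continuous (cst a : T -> R) by exact: cst_continuous.
have cavg n : continuous (fun x => `|n%:R^-1 * bsum g n x - c|).
  have cbavg : continuous (fun x => n%:R^-1 * bsum g n x).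
    exact: bavg_continuous.
  apply: (@continuous_abs _ _ (fun x => n%:R^-1 * bsum g n x - c)) => x.
  exact: (continuousB (cbavg x) (cc c x)).
have cH : continuous H by exact: cavg.
have [N1 hN1] := ces cH e3.
pose b := w%:R * (2 * B).
have b0 : 0 < b by rewrite !mulr_gt0// ltr0n.
have be : 0 <= b / (e / 3) by rewrite divr_ge0 ?ltW.
exists (N1 + (Num.bound (b / (e / 3))).+1)%N => N N1N.
have N0 : 0 < N%:R :> R by rewrite ltr0n; lia.
have bN : b / N%:R <= e / 3.
  rewrite ler_pdivrMr// mulrC -ler_pdivrMr//.
  by rewrite (le_trans (ltW (archi_boundP be)))// ler_nat; lia.
have cHk k : continuous (fun x => H (iter k F x)) by exact: comp_iter_continuous.
have cHs : continuous (fun x => \sum_(k < N) H (iter k F x)).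
  exact: (@continuous_sum _ _ N (fun k x => H (iter k F x))).
have cHa : continuous (fun x => N%:R^-1 * \sum_(k < N) H (iter k F x)).
  by move=> x; exact: (continuousM (cc N%:R^-1 x) (cHs x)).
apply: (@le_trans _ _ (\int[m]_x (e / 3 + N%:R^-1 * \sum_(k < N) H (iter k F x)))).
  apply: cInt_le => //.
    by move=> x; exact: (continuousD (cc (e / 3) x) (cHa x)).
  move=> x; apply: (@le_trans _ _ (b / N%:R + N%:R^-1 * \sum_(k < N) H (iter k F x))).
    rewrite [b / _]mulrC -mulrDr -[leLHS](mulKf (lt0r_neq0 N0)).
    rewrite ler_wpM2l ?invr_ge0 ?ler0n//.
    rewrite -[X in X * `|_|](@ger0_norm _ N%:R) ?ler0n// -normrM mulrBr mulVKf ?gt_eqF//.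
    set W := \sum_(k < N) w%:R^-1 * bsum g w (iter k F x).
    have := bsum_window N x w0 gB; rewrite -/W -/b => hW.
    have WH : `|W - N%:R * c| <= \sum_(k < N) H (iter k F x).
      have -> : N%:R * c = \sum_(k < N) c by rewrite sumr_const card_ord -[RHS]mulr_natl.
      rewrite -sumrB.
      exact: ler_norm_sum.
    have -> : bsum g N x - N%:R * c = (bsum g N x - W) + (W - N%:R * c) by lra.
    by rewrite (le_trans (ler_normD _ _))// lerD.
  by rewrite lerD2r.
have -> : \int[m]_x (e / 3 + N%:R^-1 * \sum_(k < N) H (iter k F x)) =
    e / 3 + N%:R^-1 * \sum_(k < N) \int[m]_x H (iter k F x).
  rewrite (cIntD cT _ (cc _) cHa) cInt_cst (cIntZ cT _ _ cHs).
  by congr (_ + _ * _); exact: (cInt_sum cT m N cHk).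
have hN := hN1 N (leq_trans (leq_addr _ _) N1N).
have {}hw : \int[mu]_x H x <= e / 3 := hw.
lra.
Qed.
End transfer.

(** * Sequences of upper density one *)

Section density.

Lemma sum_iota_count (n : nat -> nat) N :
  (\sum_(k < N.+1) (n k <= N))%N = count (fun k => n k <= N)%N (iota 0 N.+1).
Proof.
rewrite -(big_mkord xpredT (fun k => nat_of_bool (n k <= N)%N)).
by rewrite -sum1_count [RHS]big_mkcond /index_iota subn0; apply: eq_bigr => k _; case: leqP.
Qed.

Lemma homo_ltn_leq (n : nat -> nat) : {homo n : k l / (k < l)%N} ->
  forall k, (k <= n k)%N.
Proof. by move=> hn; elim=> // k IH; apply: leq_ltn_trans IH (hn _ _ _). Qed.

Lemma homo_ltn_inj (n : nat -> nat) : {homo n : k l / (k < l)%N} -> injective n.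
Proof.
move=> hn k l nkl; case: (ltngtP k l) => // /hn; by rewrite nkl ltnn.
Qed.

(** The indices k > k0 with n k <= N give distinct times in 1..N that satisfy [p]. The strict
    inequality ensures n k >= k >= 1; the [k0.+1] dropped indices are the error term. *)
Lemma count_excluded (n : nat -> nat) (p : pred nat) (k0 N : nat) :
  {homo n : k l / (k < l)%N} -> (forall k, (k0 <= k)%N -> p (n k)) ->
  (count (predC p) (iota 1 N) + count (fun k => n k <= N)%N (iota 0 N.+1) <=
   N + k0.+1)%N.
Proof.
move=> hn pn.
have -> : count (predC p) (iota 1 N) = (N - count p (iota 1 N))%N.
  by rewrite -{2}(size_iota 1 N) -(count_predC p) addKn.
have cN : (count p (iota 1 N) <= N)%N by rewrite -{2}(size_iota 1 N) count_size.
suff : (count (fun k => n k <= N) (iota 0 N.+1) <= k0.+1 + count p (iota 1 N))%N by lia.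
pose q k := (n k <= N)%N.
have split_count : (count q (iota 0 N.+1) <=
    k0.+1 + count (fun k => (k0 < k) && q k) (iota 0 N.+1))%N.
  rewrite (@leq_trans (count (fun k => k <= k0) (iota 0 N.+1) +
      count (fun k => (k0 < k) && q k) (iota 0 N.+1))%N)//.
    rewrite -count_predUI (leq_trans _ (leq_addr _ _))//.
    by apply: sub_count => k /= qk; rewrite qk andbT leqNgt orNb.
  rewrite leq_add2r -size_filter.
  rewrite -[leqRHS](size_iota 0) uniq_leq_size ?filter_uniq ?iota_uniq//.
  by move=> k; rewrite mem_filter !mem_iota => /andP[kk0 _]; lia.
apply: leq_trans split_count _; rewrite leq_add2l -!size_filter.
rewrite -(size_map n) uniq_leq_size//.
  by rewrite map_inj_uniq ?filter_uniq ?iota_uniq//; exact: homo_ltn_inj.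
move=> _ /mapP[k + ->]; rewrite !mem_filter !mem_iota => /andP[/andP[kk0 qk] _].
rewrite pn ?(ltnW kk0)//=.
by have := homo_ltn_leq hn k; move: qk; rewrite /q; lia.
Qed.

(** Iterating the least next element from 0 gives k < n k, so every element of [S] in 1..N has its
    index in the counted range. *)
Lemma enumerate_infinite (S : pred nat) : (forall m, exists2 s, S s & (m < s)%N) ->
  exists n : nat -> nat, [/\ {homo n : k l / (k < l)%N},
    forall k, S (n k), forall k, (k < n k)%N &
    forall N, (count S (iota 1 N) <=
      count (fun k => n k <= N)%N (iota 0 N.+1))%N].
Proof.
move=> Sinf.
have Sex m : exists s, S s && (m < s)%N.
  by have [s Ss ms] := Sinf m; exists s; rewrite Ss.
pose nxt m := ex_minn (Sex m).
have nxtP m : [/\ S (nxt m), (m < nxt m)%N &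
    forall s, S s -> (m < s)%N -> (nxt m <= s)%N].
  rewrite /nxt; case: ex_minnP => s /andP[Ss ms] smin; split=> // t St mt.
  by apply: smin; rewrite St.
pose n k := iter k.+1 nxt 0.
have hn : {homo n : k l / (k < l)%N}.
  apply: homo_ltn; first exact: ltn_trans.
  by move=> k; rewrite /n [in ltnRHS]iterS; have [] := nxtP (iter k.+1 nxt 0).
have nk k : (k < n k)%N.
  elim: k => [|k IH]; first by have [] := nxtP 0%N.
  exact: leq_ltn_trans IH (hn _ _ (ltnSn k)).
exists n; split=> //; first by move=> k; rewrite /n iterS; have [] := nxtP (iter k nxt 0).
move=> N; rewrite -!size_filter -[leqRHS](size_map n) uniq_leq_size//.
  by rewrite filter_uniq ?iota_uniq.
move=> s; rewrite mem_filter mem_iota => /andP[Ss /andP[s1 sN]].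
have exk : exists k, (s <= n k)%N by exists s; exact: ltnW.
case: (ex_minnP exk) => k sk kmin.
have nks : n k = s.
  apply/eqP; rewrite eqn_leq sk andbT /n iterS.
  case: k sk kmin => [|k] sk kmin; first by have [_ _] := nxtP 0%N; apply.
  have [_ _] := nxtP (n k); apply=> //.
  by rewrite ltnNge; apply/negP => /kmin; rewrite ltnn.
apply/mapP; exists k => //; rewrite mem_filter mem_iota nks; have := nk k; lia.
Qed.

(** Between the scales [Nseq j] and [Nseq j.+1] a time is accepted when [p j] holds. Each scale
    dwarfs the previous one, so few times are rejected up to the end of a late block. The density
    bound, count >= (1 - 1/e) N, is written in natural numbers. *)
Lemma density_diagonal (p : nat -> pred nat) :
  (forall j N0, exists N, (N0 <= N)%N /\
    (count (predC (p j)) (iota 1 N) * j.+1 <= N)%N) ->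
  exists n : nat -> nat, [/\ {homo n : k l / (k < l)%N},
    forall k, (k < n k)%N,
    forall e N0, exists N, (N0 < N)%N /\
      (e * N <= e * count (fun k => n k <= N) (iota 0 N.+1) + N)%N &
    forall J, exists k0, forall k, (k0 <= k)%N ->
      exists2 j, (J <= j)%N & p j (n k)].
Proof.
move=> H.
have [f hf] : exists f : nat -> nat -> nat, forall j N0, (N0 <= f j N0)%N /\
    (count (predC (p j)) (iota 1 (f j N0)) * j.+1 <= f j N0)%N.
  have [f hf] := choice (fun jN : nat * nat => H jN.1 jN.2).
  by exists (fun j N0 => f (j, N0)) => j N0; exact: (hf (j, N0)).
pose fix Nseq j := if j is j'.+1 then f j' (j'.+1 * Nseq j').+1 else 0%N.
have NS j : (j.+1 * Nseq j < Nseq j.+1)%N by have [] := hf j (j.+1 * Nseq j).+1.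
have Nbad j : (count (predC (p j)) (iota 1 (Nseq j.+1)) * j.+1 <= Nseq j.+1)%N.
  by have [] := hf j (j.+1 * Nseq j).+1.
have Nlt : {homo Nseq : i j / (i < j)%N}.
  apply: homo_ltn; first exact: ltn_trans.
  by move=> j; apply: leq_ltn_trans (NS j); rewrite leq_pmull.
have Nle : {homo Nseq : i j / (i <= j)%N}.
  by move=> i j; rewrite leq_eqVlt => /predU1P[->//|/Nlt/ltnW].
have Nge j : (j <= Nseq j)%N by exact: homo_ltn_leq.
pose S n := `[< exists j, [/\ (Nseq j < n)%N, (n <= Nseq j.+1)%N & p j n] >].
have nonS j : (j.+1 * count (predC S) (iota 1 (Nseq j.+1)) <= 2 * Nseq j.+1)%N.
  (* All times up to [Nseq j] are given up; each of the two terms is at most a fraction 1/(j+1) of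
     [Nseq j.+1]. *)
  suff : (count (predC S) (iota 1 (Nseq j.+1)) <=
      Nseq j + count (predC (p j)) (iota 1 (Nseq j.+1)))%N.
    by have := Nbad j; have := NS j; nia.
  rewrite (@leq_trans (count (fun n => n <= Nseq j) (iota 1 (Nseq j.+1)) +
      count (predC (p j)) (iota 1 (Nseq j.+1)))%N)//.
    rewrite -count_predUI (leq_trans _ (leq_addr _ _))// -!size_filter.
    rewrite uniq_leq_size ?filter_uniq ?iota_uniq// => n.
    rewrite !mem_filter => /andP[/= nS nI]; rewrite nI andbT.
    case: leqP => //= jn; apply: contra nS => pn; apply/asboolP; exists j.
    by move: nI; rewrite mem_iota => /andP[_ nI]; split=> //; lia.
  rewrite leq_add2r -size_filter.
  rewrite -[leqRHS](size_iota 1) uniq_leq_size ?filter_uniq ?iota_uniq//.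
  by move=> k; rewrite mem_filter !mem_iota => /andP[kj /andP[k1 _]]; lia.
have cS j : (count S (iota 1 (Nseq j.+1)) + count (predC S) (iota 1 (Nseq j.+1)) =
    Nseq j.+1)%N by rewrite count_predC size_iota.
have Sinf m : exists2 s, S s & (m < s)%N.
  apply: contrapT => /forall2NP Sm.
  have cm : (count S (iota 1 (Nseq (m + 3).+1)) <= m)%N.
    rewrite -size_filter -[leqRHS](size_iota 1) uniq_leq_size ?filter_uniq ?iota_uniq//.
    move=> s; rewrite mem_filter !mem_iota => /andP[Ss /andP[s1 _]].
    by have [//|/negP] := Sm s; rewrite -leqNgt => sm; lia.
  have := nonS (m + 3)%N; have := cS (m + 3)%N; have := Nge (m + 3).+1; nia.
have [n [hn Sn kn nS]] := enumerate_infinite Sinf.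
exists n; split=> //.
  (* [2 * e] absorbs the factor 2 of [nonS]; [N0] makes the scale large enough. *)
  move=> e N0; pose j := (2 * e + N0).+1; exists (Nseq j.+1); split.
    by have := Nge j.+1; rewrite /j; lia.
  have := nS (Nseq j.+1); have := cS j; have := nonS j.
  by rewrite /j; nia.
(* Beyond [Nseq J] only blocks of index at least [J] remain. *)
move=> J; exists (Nseq J).+1 => k Jk.
have /asboolP[j [jn nj pj]] := Sn k; exists j => //.
rewrite leqNgt; apply/negP => jJ.
by have := Nle _ _ jJ; have := kn k; lia.
Qed.
End density.

(** * The basin *)

Section basin.
Context {R : realType} {d : nat} (M : closedRiemannianManifold R d).

Lemma upper_density_frequently (n : nat -> nat) (e : R) N0 :
  upper_density (R := R) n = 1%E -> 0 < e -> exists2 N, (N0 <= N)%N &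
    (1 - e) * N%:R <= (count (fun k => n k <= N)%N (iota 0 N.+1))%:R.
Proof.
move=> n1 e0; apply: contrapT => /forall2NP H.
have : (upper_density (R := R) n <= (1 - e)%:E)%E.
  apply: (@le_trans _ _ (ereal_sup [set ((\sum_(k < N.+1) (n k <= N))%N%:R / N%:R : R)%:E
      | N in [set N | (N0.+1 <= N)%N]])).
    (* The upper limit is an infimum over sets of the filter; the tail from [N0.+1] is one of them
       and avoids N = 0. *)
    by apply: ereal_inf_lbound; exists [set N | (N0.+1 <= N)%N] => //; exists N0.+1.
  apply: ge_ereal_sup => _ [N /= N0N <-]; rewrite lee_fin.
  rewrite ler_pdivrMr ?ltr0n ?(leq_trans _ N0N)// sum_iota_count.
  by have [|/negP] := H N; [rewrite (ltnW N0N)|rewrite -ltNge => /ltW].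
by rewrite n1 lee_fin; lra.
Qed.

Lemma upper_density_eq1 (n : nat -> nat) : {homo n : k l / (k < l)%N} ->
  (forall k, (k < n k)%N) ->
  (forall e N0, exists N, (N0 < N)%N /\
    (e * N <= e * count (fun k => n k <= N) (iota 0 N.+1) + N)%N) ->
  upper_density (R := R) n = 1%E.
Proof.
move=> hn kn nfreq; apply/eqP; rewrite eq_le; apply/andP; split.
  apply: (@le_trans _ _ (ereal_sup [set ((\sum_(k < N.+1) (n k <= N))%N%:R / N%:R : R)%:E
      | N in [set: nat]])).
    by apply: ereal_inf_lbound; exists setT => //; exists 0%N.
  apply: ge_ereal_sup => _ [N _ <-]; rewrite lee_fin.
  have [->|N0] := posnP N; first by rewrite invr0 mulr0 ler01.
  rewrite ler_pdivrMr ?ltr0n// mul1r ler_nat sum_iota_count.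
  rewrite -addn1 iotaD count_cat/= addn0.
  (* The sum has N + 1 terms; the last one vanishes because N < n N, so the ratio is at most 1. *)
  have -> : (n (0 + N) <= N)%N = false by rewrite add0n leqNgt kn.
  by rewrite addn0 -[leqRHS](size_iota 0 N) count_size.
apply/le_ereal_inf_tmp => _ [A [N0 _ N0A] <-].
apply/lee_subgt0Pr => e e0.
have [N [N0N hN]] := nfreq (Num.bound e^-1).+1 N0.
apply: (@le_trans _ _ ((\sum_(k < N.+1) (n k <= N))%N%:R / N%:R : R)%:E); last first.
  by apply: ereal_sup_ubound; exists N => //; apply: N0A; exact: ltnW.
have Np : 0 < N%:R :> R by rewrite ltr0n (leq_ltn_trans _ N0N).
rewrite -EFinB lee_fin ler_pdivlMr// sum_iota_count.
set C := count _ _ in hN *.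
have b0 : 0 <= e^-1 by rewrite invr_ge0 ltW.
have : e^-1 <= (Num.bound e^-1).+1%:R.
  by rewrite (le_trans (ltW (archi_boundP b0)))// ler_nat.
move: hN; rewrite -(@ler_nat R) natrD !natrM; set K := _.+1%:R => hN eK.
have eK1 : 1 <= e * K by rewrite -ler_pdivrMl// mulr1.
have : e * (K * N%:R) <= e * (K * C%:R + N%:R) by rewrite ler_wpM2l// ltW.
have K0 : 0 < K by rewrite ltr0n.
have : K * N%:R - K * C%:R <= N%:R by lra.
rewrite -mulrBr => KN _.
have : N%:R - C%:R <= N%:R / K by rewrite ler_pdivlMr// mulrC.
have : N%:R / K <= e * N%:R.
  by rewrite ler_pdivrMr// mulrAC ler_peMl// ltW.
by move=> h1 h2; have := le_trans h2 h1; lra.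
Qed.

Lemma cesaro_small (a : nat -> R) :
  (forall e, 0 < e -> exists N0, forall n, (N0 <= n)%N -> a n <= e) ->
  forall e, 0 < e -> exists N1, forall N, (N1 <= N)%N ->
    \sum_(k < N) a k.+1 <= e * N%:R.
Proof.
move=> ha e e0; have e2 : 0 < e / 2 by rewrite divr_gt0.
have [N0 hN0] := ha _ e2.
pose C := `|\sum_(k < N0) a k.+1|.
have step p : \sum_(k < N0 + p) a k.+1 <= C + (e / 2) * p%:R.
  elim: p => [|p IH]; first by rewrite addn0 mulr0 addr0 ler_norm.
  rewrite addnS big_ord_recr/=.
  have := hN0 (N0 + p).+1 (leqW (leq_addr _ _)).
  by rewrite -[p.+1%:R]natr1 mulrDr mulr1; lra.
have Ce : 0 <= C / (e / 2) by rewrite divr_ge0 ?normr_ge0// ltW.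
exists (N0 + Num.bound (C / (e / 2)))%N => N N1N.
have -> : N = (N0 + (N - N0))%N by lia.
rewrite (le_trans (step _))//.
have : C <= (e / 2) * (N0 + (N - N0))%N%:R.
  rewrite mulrC -ler_pdivrMr// (le_trans (ltW (archi_boundP Ce)))// ler_nat; lia.
have : (e / 2) * (N - N0)%N%:R <= (e / 2) * (N0 + (N - N0))%N%:R.
  by rewrite ler_wpM2l ?(ltW e2)// ler_nat leq_addl.
lra.
Qed.

Lemma eventually_forall_ord (J : nat) (P : nat -> nat -> Prop) :
  (forall i, exists N0, forall n, (N0 <= n)%N -> P i n) ->
  exists N0, forall n, (N0 <= n)%N -> forall i : 'I_J, P i n.
Proof.
move=> /choice[N hN]; exists (\max_(i < J) N i)%N => n Nn i; apply: hN.
by apply: leq_trans Nn; apply: (leq_bigmax (F := fun i : 'I_J => N i)).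
Qed.

Variables (f : M -> M) (mu : probability (borel M) R).
Variable gf : nat -> M -> R.
Hypothesis cgf : forall i, continuous (gf i).
Hypothesis gf_dense : forall h (e : R), continuous h -> 0 < e ->
  exists i, forall x, `|gf i x - h x| < e.

Let cT : compact [set: M] := @carrier_compact _ _ M.

Definition deviation (g : M -> R) (n : nat) (y : M) : R :=
  `|n%:R^-1 * bsum f g n y - \int[mu]_x g x|.

(* psi j n y >= 1 as soon as one of the first j + 1 test functions deviates by
   1 / (j + 1); using the continuous psi instead of the indicators of these events
   reduces Markov's inequality to integrals of continuous functions. *)
Definition psi (j n : nat) (y : M) : R :=
  j.+1%:R * \sum_(i < j.+1) deviation (gf i) n y.

Definition bad_time (j : nat) (y : M) (n : nat) : bool := 1 <= psi j n y.

Definition good_times (j N : nat) : set (borel M) :=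
  [set y | (count (bad_time j y) (iota 1 N) * j.+1 <= N)%N].

Lemma psi_ge0 j n y : 0 <= psi j n y.
Proof. by rewrite mulr_ge0// sumr_ge0// => i _; exact: normr_ge0. Qed.

Lemma deviation_le_psi j n y (i : nat) : (i <= j)%N ->
  j.+1%:R * deviation (gf i) n y <= psi j n y.
Proof.
move=> ij; rewrite ler_wpM2l// (bigD1 (Ordinal (ij : (i < j.+1)%N)))//= lerDl.
by apply: sumr_ge0 => k _; exact: normr_ge0.
Qed.

Lemma deviation_perturb g h e n y : continuous g -> continuous h ->
  (forall x, `|h x - g x| <= e) -> (0 < n)%N ->
  deviation g n y <= deviation h n y + 2 * e.
Proof.
move=> cg ch hg n0; rewrite /deviation.
have np : 0 < n%:R :> R by rewrite ltr0n.
have sums : `|n%:R^-1 * bsum f g n y - n%:R^-1 * bsum f h n y| <= e.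
  rewrite -mulrBr normrM ger0_norm ?invr_ge0 ?ler0n// ler_pdivrMl//.
  rewrite /bsum -sumrB (le_trans (ler_norm_sum _ _ _))//.
  have -> : n%:R * e = \sum_(j < n) e by rewrite sumr_const card_ord -[RHS]mulr_natl.
  by apply: ler_sum => j _; rewrite distrC.
have ints : `|\int[mu]_x h x - \int[mu]_x g x| <= e.
  have chg : continuous (fun x => h x - g x).
    by move=> x; apply: (continuousB (ch x) (cg x)).
  rewrite -(cIntB cT mu ch cg) (le_trans (cInt_norm cT mu chg))//.
  rewrite -[leRHS](cInt_cst mu); apply: cInt_le => //.
  - exact: continuous_abs.
  - exact: cst_continuous.
set a := _ * bsum f g n y in sums *; set b := _ * bsum f h n y in sums *.
move: sums ints; set u := \int[mu]_x h x; set v := \int[mu]_x g x => sums ints.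
have -> : a - v = (a - b) + (b - u) + (u - v) by lra.
by rewrite !(le_trans (ler_normD _ _))// ; have := ler_normD (a - b) (b - u); lra.
Qed.

(** An exact equality: quantifiers over sequences and over continuous functions become countable
    ones, which also gives the measurability of the basin. *)
Lemma basinE : basin f mu =
  \bigcap_j \bigcap_N0 \bigcup_(N in [set N | (N0 <= N)%N]) good_times j N.
Proof.
apply/seteqP; split => y.
- move=> [n [hn n1 ny]] j _ N0 _.
  (* With the weight j+1 and j+1 terms of this size, [psi] is at most 1/2, hence below 1. *)
  have dev_small i : exists K, forall k, (K <= k)%N ->
      deviation (gf i) (n k) y <= (2 * (j.+1%:R * j.+1%:R))^-1.
    have e0 : 0 < (2 * (j.+1%:R * j.+1%:R))^-1 :> R by rewrite invr_gt0 !mulr_gt0.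
    have /cvgrPdist_le/(_ _ e0)[K _ hK] := ny _ (@cgf i).
    by exists K => k Kk; rewrite /deviation distrC; exact: hK.
  have [K hK] := @eventually_forall_ord j.+1
    (fun i k => deviation (gf i) (n k) y <= (2 * (j.+1%:R * j.+1%:R))^-1) dev_small.
  have good k : (K <= k)%N -> ~~ bad_time j y (n k).
    move=> Kk; rewrite -ltNge; apply: (@le_lt_trans _ _ 2^-1); last by lra.
    rewrite /psi (@le_trans _ _ (j.+1%:R * \sum_(i < j.+1) (2 * (j.+1%:R * j.+1%:R))^-1))//.
      by rewrite ler_wpM2l// ler_sum// => i _; exact: hK.
    rewrite sumr_const card_ord -[X in _ * X]mulr_natl mulrA invfM mulrCA mulfV ?mulr1 ?mulf_neq0//.
  have cE N := @count_excluded n (predC (bad_time j y)) K N hn good.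
  (* Times off the sequence use half of the allowance N/(j+1); the lower bound on [N] leaves the
     other half for the [K.+1] discarded indices. *)
  have e0 : 0 < (2 * j.+1%:R)^-1 :> R by rewrite invr_gt0 mulr_gt0.
  have [N N0N hN] := upper_density_frequently (N0 + 2 * j.+1 * K.+1) n1 e0.
  exists N => /=; first by lia.
  have := cE N; set c1 := count _ _; set c2 := count _ _ => c12.
  rewrite /good_times/=; have -> : count (bad_time j y) (iota 1 N) = c1.
    by apply: eq_count => k; rewrite /= negbK.
  have H2 : 2 * j.+1%:R * N%:R <= 2 * j.+1%:R * c2%:R + N%:R :> R.
    move: e0 hN; set J2 := 2 * _ => e0 hN.
    have J0 : 0 < J2 by rewrite -invr_gt0.
    have := ler_wpM2l (ltW J0) hN.
    have : J2 * (J2^-1 * N%:R) = N%:R by rewrite mulVKf// gt_eqF.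
    by rewrite mulrBl mul1r mulrBr => ->; rewrite -/c2; lra.
  move: H2; rewrite -!natrM -natrD ler_nat => H2.
  nia.
- move=> Hy.
  have [|n [hn kn nfreq nJ]] := @density_diagonal (fun j n => ~~ bad_time j y n).
    move=> j N0; have [N /= N0N yN] := Hy j Logic.I N0 Logic.I.
    exists N; split=> //; move: yN; rewrite /good_times/=.
    by rewrite (eq_count (_ : predC _ =1 bad_time j y))// => n; rewrite /= negbK.
  exists n; split=> //; first exact: upper_density_eq1.
  move=> g cg; apply/cvgrPdist_le => e e0.
  have e4 : 0 < e / 4 by rewrite divr_gt0.
  have [i hi] := gf_dense cg e4.
  (* A level beyond [i] tests [gf i]; a level beyond 4/e tests it to precision e/4. Replacing [gf i]
     by [g] adds 2 (e/4). *)
  have [K hK] := nJ (i + Num.bound (e / 4)^-1)%N.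
  exists K => // k /hK[j ij]; rewrite -ltNge => psij.
  have hgi x : `|gf i x - g x| <= e / 4 by rewrite ltW.
  have nk0 : (0 < n k)%N by exact: leq_ltn_trans (kn k).
  rewrite distrC; apply: le_trans (deviation_perturb y cg (@cgf i) hgi nk0) _.
  suff : deviation (gf i) (n k) y <= e / 4 by lra.
  have := @deviation_le_psi j (n k) y i (leq_trans (leq_addr _ _) ij).
  have dev0 : 0 <= deviation (gf i) (n k) y by exact: normr_ge0.
  have b0 : 0 <= (e / 4)^-1 by rewrite invr_ge0 ltW.
  have : (e / 4)^-1 <= j.+1%:R.
    rewrite (le_trans (ltW (archi_boundP b0)))// ler_nat; lia.
  move=> ej hpsi.
  have : (e / 4)^-1 * deviation (gf i) (n k) y <= 1.
    by rewrite (le_trans _ (ltW psij))// (le_trans _ hpsi)// ler_wpM2r.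
  by rewrite ler_pdivrMl// mulr1.
Qed.
End basin.

(** * Measurability and full measure of the basin *)

Section full.
Context {R : realType} {d : nat} (M : closedRiemannianManifold R d).

Lemma count_measurable (A : nat -> M -> bool) (s : seq nat) (c : nat) :
  (forall n, measurable ([set y | A n y] : set (borel M))) ->
  measurable ([set y | count (A^~ y) s = c] : set (borel M)).
Proof.
move=> mA; elim: s c => [|n s IH] c /=.
  have [->|c0] := eqVneq c 0%N.
    by rewrite (_ : mkset _ = setT)//; apply/seteqP; split.
  rewrite (_ : mkset _ = set0)//; apply/seteqP; split => // y /= h.
  by move: c0; rewrite -h.
rewrite (_ : mkset _ =
  ([set y | A n y] `&` (if c is c'.+1 then [set y | count (A^~ y) s = c'] else set0)) `|`
  (~` [set y | A n y] `&` [set y | count (A^~ y) s = c])).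
  apply: measurableU; apply: measurableI => //.
    by case: c => [|c]; [exact: measurable0|exact: IH].
  exact: measurableC.
apply/seteqP; split => y /=.
- move=> <-; case: (A n y) => /=; last by right.
  by left; split.
- case: c => [|c] [[Ay]|[/negP/negbTE Ay]] //= <-; first by rewrite Ay.
  + by rewrite Ay.
  + by rewrite Ay.
Qed.

Variables (f : M -> M) (m mu : probability (borel M) R).
Hypothesis cf : continuous f.
Variable gf : nat -> M -> R.
Hypothesis cgf : forall i, continuous (gf i).
Hypothesis gf_dense : forall h (e : R), continuous h -> 0 < e ->
  exists i, forall x, `|gf i x - h x| < e.
Hypothesis inv : forall A : set (borel M), measurable A -> mu (f @^-1` A) = mu A.
Hypothesis erg : forall A : set (borel M), measurable A -> f @^-1` A = A ->
  mu A = 0%E \/ mu A = 1%E.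
Hypothesis ces : forall g (e : R), continuous g -> 0 < e ->
  exists N0, forall N, (N0 <= N)%N ->
    N%:R^-1 * (\sum_(k < N) \int[m]_x g (iter k f x)) <= \int[mu]_x g x + e.

Let cT : compact [set: M] := @carrier_compact _ _ M.

Lemma deviation_continuous g n : continuous g -> continuous (deviation f mu g n).
Proof.
move=> cg; have cbavg : continuous (fun x => n%:R^-1 * bsum f g n x).
  exact: bavg_continuous.
have cc : continuous (cst (\int[mu]_x g x) : M -> R) by exact: cst_continuous.
apply: (@continuous_abs _ _ (fun x => n%:R^-1 * bsum f g n x - _)) => x.
exact: (continuousB (cbavg x) (cc x)).
Qed.

Lemma psi_continuous j n : continuous (psi f mu gf j n).
Proof.
have cs : continuous (fun y => \sum_(i < j.+1) deviation f mu (gf i) n y).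
  apply: (@continuous_sum _ _ _ (fun i y => deviation f mu (gf i) n y)) => i.
  exact: deviation_continuous.
have cc : continuous (cst j.+1%:R : M -> R) by exact: cst_continuous.
by move=> y; exact: (continuousM (cc y) (cs y)).
Qed.

Lemma good_times_measurable j N : measurable (good_times f mu gf j N).
Proof.
rewrite (_ : good_times f mu gf j N = \bigcup_(c in [set c | (c * j.+1 <= N)%N])
    [set y | count (bad_time f mu gf j y) (iota 1 N) = c]); last first.
  apply/seteqP; split => [y yN|y [c /= cN yc]].
    by exists (count (bad_time f mu gf j y) (iota 1 N)).
  by rewrite /good_times/= yc.
apply: bigcup_measurable => c _.
apply: (@count_measurable (fun n y => bad_time f mu gf j y n)) => n.
rewrite (_ : mkset _ = ~` [set y | psi f mu gf j n y < 1]); last first.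
  by apply/seteqP; split => y /=; rewrite /bad_time leNgt => /negP.
apply: measurableC; apply: open_borel.
apply: (@open_lt_fun _ _ (psi f mu gf j n) (cst 1)); first exact: psi_continuous.
exact: cst_continuous.
Qed.

Lemma basin_measurable : measurable (basin f mu).
Proof.
rewrite (basinE f mu cgf gf_dense).
apply: bigcap_measurable => // j _; apply: bigcap_measurable => // N0 _.
apply: bigcup_measurable => N _; exact: good_times_measurable.
Qed.

Lemma psi_small j (e : R) : 0 < e -> exists N0, forall n, (N0 <= n)%N ->
  \int[m]_y psi f mu gf j n y <= e.
Proof.
move=> e0; pose J : R := j.+1%:R; have J0 : 0 < J by rewrite ltr0n.
(* One factor [J] for the weight in [psi], one for the number of its terms. *)
have d0 : 0 < e / (J * J) by rewrite divr_gt0// mulr_gt0.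
have [N0 hN0] := @eventually_forall_ord j.+1
  (fun i n => \int[m]_y deviation f mu (gf i) n y <= e / (J * J))
  (fun i => reference_mean_ergodic cT cf inv erg ces (@cgf i) d0).
exists N0 => n /hN0 hn.
have cd i : continuous (fun y => deviation f mu (gf i) n y).
  exact: deviation_continuous.
have cs : continuous (fun y => \sum_(i < j.+1) deviation f mu (gf i) n y).
  exact: (@continuous_sum _ _ j.+1 (fun i y => deviation f mu (gf i) n y)).
have -> : \int[m]_y psi f mu gf j n y =
    J * \sum_(i < j.+1) \int[m]_y deviation f mu (gf i) n y.
  rewrite (cIntZ cT _ _ cs); congr (_ * _).
  exact: (cInt_sum cT m j.+1 cd).
apply: (@le_trans _ _ (J * \sum_(i < j.+1) (e / (J * J)))).
  by rewrite ler_wpM2l ?(ltW J0)// ler_sum// => i _; exact: hn.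
rewrite sumr_const card_ord -[X in _ * X]mulr_natl -/J mulrA mulrC.
by rewrite divfK// mulf_neq0// gt_eqF.
Qed.

(** Off [good_times], (j+1) times the number of bad times exceeds [N], and that number is at most
    the sum of the [psi], whose integral is small by Cesaro averaging. *)
Lemma good_times_compl_small j N0 (e : R) : 0 < e ->
  exists2 N, (N0 <= N)%N & (m (~` good_times f mu gf j N) <= e%:E)%E.
Proof.
move=> e0; pose J : R := j.+1%:R; have J0 : 0 < J by rewrite ltr0n.
have eJ : 0 < e / J by rewrite divr_gt0.
have [N1 hN1] := cesaro_small (@psi_small j) eJ.
pose N := (N0 + N1).+1; exists N; first by rewrite /N; lia.
have Np : 0 < N%:R :> R by rewrite ltr0n.
have cp n : continuous (fun y => psi f mu gf j n.+1 y) by exact: psi_continuous.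
have cs : continuous (fun y => \sum_(n < N) psi f mu gf j n.+1 y).
  exact: (@continuous_sum _ _ N (fun n y => psi f mu gf j n.+1 y)).
have cJs : continuous (fun y => J * \sum_(n < N) psi f mu gf j n.+1 y).
  have cc : continuous (cst J : M -> R) by exact: cst_continuous.
  by move=> y; exact: (continuousM (cc y) (cs y)).
pose A : set (borel M) := ~` good_times f mu gf j N.
have mA : measurable A by apply: measurableC; exact: good_times_measurable.
have count_le y : (count (bad_time f mu gf j y) (iota 1 N))%:R <=
    \sum_(n < N) psi f mu gf j n.+1 y.
  rewrite -sum1_count natr_sum big_mkcond.
  rewrite -[X in iota X]addn0 iotaDl big_map.
  rewrite (_ : iota 0 N = index_iota 0 N) ?big_mkord; last by rewrite /index_iota subn0.
  apply: ler_sum => n _.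
  by rewrite add1n; case: ifP => // _; exact: psi_ge0.
have : \int[m]_y (0 : R) <= \int[m]_y (J * \sum_(n < N) psi f mu gf j n.+1 y) +
    (- N%:R) * fine (m A).
  apply: cInt_le_indic => //; first exact: cst_continuous.
  move=> y; rewrite indicE; case: (boolP (y \in A)) => [|_].
    rewrite inE /A/= /good_times/= => /negP; rewrite -ltnNge => hy.
    rewrite mulr1 subr_ge0 (@le_trans _ _ (J * (count (bad_time f mu gf j y) (iota 1 N))%:R))//.
      by rewrite -natrM ler_nat mulnC ltnW.
    by rewrite ler_wpM2l// ltW.
  rewrite mulr0 addr0 mulr_ge0// ?(ltW J0)// sumr_ge0// => n _.
  exact: psi_ge0.
rewrite cInt_cst (cIntZ cT _ _ cs).
have -> : \int[m]_y (\sum_(n < N) psi f mu gf j n.+1 y) =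
    \sum_(n < N) \int[m]_y psi f mu gf j n.+1 y.
  exact: (cInt_sum cT m N cp).
have := hN1 N; rewrite (_ : (N1 <= N)%N); last by rewrite /N; lia.
move=> /(_ isT) hN hA.
have {}hN : J * \sum_(n < N) \int[m]_y psi f mu gf j n.+1 y <= e * N%:R.
  by rewrite -ler_pdivlMl// mulrA [J^-1 * e]mulrC.
have : N%:R * fine (m A) <= N%:R * e by lra.
rewrite ler_pM2l// => mAe.
by rewrite -/A -(@fineK _ (m A)) ?lee_fin// fin_num_measure.
Qed.

Lemma basin_full : m (basin f mu) = 1%E.
Proof.
have mU j N0 : measurable
    (\bigcup_(N in [set N | (N0 <= N)%N]) good_times f mu gf j N).
  by apply: bigcup_measurable => N _; exact: good_times_measurable.
(* [N] is free above the fixed [N0], so this set lies in complements of arbitrarily small measure;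
   no summability is involved. *)
have U1 j N0 : m (~` (\bigcup_(N in [set N | (N0 <= N)%N]) good_times f mu gf j N)) = 0%E.
  apply/eqP; rewrite eq_le measure_ge0 andbT; apply/lee_addgt0Pr => e e0.
  rewrite add0e; have [N N0N] := good_times_compl_small j N0 e0.
  apply: le_trans; apply: le_measure; rewrite ?inE.
  - exact: measurableC.
  - by apply: measurableC; exact: good_times_measurable.
  - by apply: subsetC => y yN; exists N.
have mB := basin_measurable.
suff B0 : m (~` basin f mu) = 0%E.
  have := probability_setC m (measurableC mB).
  by rewrite setCK B0 sube0.
have : m.-negligible (~` basin f mu).
  rewrite (basinE f mu cgf gf_dense) setC_bigcap; apply: negligible_bigcup => j.
  rewrite setC_bigcap; apply: negligible_bigcup => N0.
  apply/negligibleP; first exact: measurableC.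
  exact: U1.
by move/negligibleP; apply; exact: measurableC.
Qed.
End full.

(** * From the exponential rate to Cesaro convergence *)

Section assembly.
Context {R : realType}.

Lemma expR_decay_small (a c e : R) : 0 < c -> 0 < e ->
  exists2 n, (1 <= n)%N & a * expR (- c * n%:R) <= e.
Proof.
move=> c0 e0; have b0 : 0 <= `|a| / (e * c) by rewrite divr_ge0// mulr_ge0 ?ltW.
pose n := (Num.bound (`|a| / (e * c))).+1; exists n => //.
have an : `|a| <= e * (c * n%:R).
  rewrite mulrA mulrC -ler_pdivrMr ?mulr_gt0//.
  by rewrite (le_trans (ltW (archi_boundP b0)))// ler_nat.
rewrite (le_trans (ler_wpM2r (expR_ge0 _) (ler_norm a)))//.
rewrite mulNr expRN ler_pdivrMr ?expR_gt0// (le_trans an)// ler_wpM2l ?ltW//.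
by rewrite (lt_le_trans _ (expR_ge1Dx _))// ltrDr.
Qed.

(** Fixing [n] first makes min{n, N} equal to [n] for large [N], so the rate becomes a fixed small
    error. Moving the window back to 0 costs at most 2nB/N, and replacing [g] by [h] costs e/4 under
    each measure. *)
Lemma cesaro_of_rate (T : ptopologicalType) (F : T -> T)
    (m mu : probability (borel T) R) (C c : R) (h g : T -> R) (e : R) :
  compact [set: T] -> continuous F -> continuous h -> continuous g -> 0 < c -> 0 < e ->
  (forall n N, (1 <= n)%N -> (1 <= N)%N ->
     `| N%:R^-1 * (\sum_(n <= k < n + N) \int[m]_x h (iter k F x))
        - \int[mu]_x h x | <= C * expR (- c * (minn n N)%:R)) ->
  (forall x, `|h x - g x| < e / 4) ->
  exists N0, forall N, (N0 <= N)%N ->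
    N%:R^-1 * (\sum_(k < N) \int[m]_x g (iter k F x)) <= \int[mu]_x g x + e.
Proof.
move=> cT cF ch cg c0 e0 rate hg.
have e4 : 0 < e / 4 by rewrite divr_gt0.
have [n n1 hn] := expR_decay_small C c0 e4.
have [B B0 hB] := compact_continuous_bounded cT ch.
have be : 0 <= n%:R * (2 * B) / (e / 4).
  by rewrite divr_ge0 ?(ltW e4)// !mulr_ge0// ltW.
exists (n + Num.bound (n%:R * (2 * B) / (e / 4)))%N => N nN.
have N1 : (1 <= N)%N by lia.
have Np : 0 < N%:R :> R by rewrite ltr0n.
pose a k := \int[m]_x h (iter k F x).
have chk k : continuous (fun x => h (iter k F x)) by exact: comp_iter_continuous.
have aB k : `|a k| <= B.
  rewrite (le_trans (cInt_norm cT m (chk k)))// -[leRHS](cInt_cst m).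
  by apply: cInt_le => //; [exact: continuous_abs|exact: cst_continuous].
have ga k : \int[m]_x g (iter k F x) <= a k + e / 4.
  rewrite -[e / 4](cInt_cst m) -(cIntD cT m (chk k)); last exact: cst_continuous.
  apply: cInt_le => //; first exact: comp_iter_continuous.
    move=> x; apply: (continuousD (chk k x)); exact: cst_continuous.
  by move=> x; have := hg (iter k F x); rewrite ltr_distl => /andP[]; lra.
have hmu : \int[mu]_x h x <= \int[mu]_x g x + e / 4.
  rewrite -[e / 4](cInt_cst mu) -(cIntD cT mu cg); last exact: cst_continuous.
  apply: cInt_le => //.
    by move=> x; apply: (continuousD (cg x)); exact: cst_continuous.
  by move=> x; have := hg x; rewrite ltr_distl => /andP[]; lra.
have shift p : `|\sum_(k < N) a k - \sum_(p <= k < p + N) a k| <= p%:R * (2 * B).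
  elim: p => [|p IH]; first by rewrite add0n big_mkord subrr normr0 mul0r.
  have E : \sum_(p.+1 <= k < p.+1 + N) a k =
      \sum_(p <= k < p + N) a k + a (p + N)%N - a p.
    have := @big_nat_recr _ _ +%R (p + N)%N p a (leq_addr _ _).
    rewrite big_ltn ?ltnS ?leq_addr// addSn /=; lra.
  rewrite E (_ : _ - _ = (\sum_(k < N) a k - \sum_(p <= k < p + N) a k) +
    (a p - a (p + N)%N)); last lra.
  rewrite -[p.+1%:R]natr1 mulrDl mul1r (le_trans (ler_normD _ _))// lerD//.
  rewrite (le_trans (ler_normB _ _))//.
  by have := aB p; have := aB (p + N)%N; lra.
have nNb : n%:R * (2 * B) / N%:R <= e / 4.
  rewrite ler_pdivrMr// [e / 4 * _]mulrC -ler_pdivrMr//.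
  by rewrite (le_trans (ltW (archi_boundP be)))// ler_nat; lia.
have gsum : N%:R^-1 * (\sum_(k < N) \int[m]_x g (iter k F x)) <=
    N%:R^-1 * (\sum_(k < N) a k) + e / 4.
  have -> : e / 4 = N%:R^-1 * \sum_(k < N) (e / 4).
    by rewrite sumr_const card_ord -[e / 4 *+ N]mulr_natl mulKf// gt_eqF.
  by rewrite -mulrDr -big_split ler_wpM2l ?invr_ge0 ?ler0n// ler_sum.
have nN' : minn n N = n by apply/minn_idPl; lia.
have rt0 := rate n N n1 N1; rewrite nN' in rt0.
have := le_trans rt0 hn; rewrite ler_distl => /andP[_ rt].
have asum : N%:R^-1 * (\sum_(k < N) a k) <=
    N%:R^-1 * (\sum_(n <= k < n + N) a k) + e / 4.
  rewrite (le_trans _ (lerD (lexx _) nNb))// [_ / N%:R]mulrC -mulrDr.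
  rewrite ler_wpM2l ?invr_ge0 ?ler0n//.
  by have := shift n; rewrite ler_distl => /andP[]; lra.
have rt' : N%:R^-1 * (\sum_(n <= k < n + N) a k) <= \int[mu]_x h x + e / 4 := rt.
lra.
Qed.

(** Rational codes are countable, hence a sequence; the Lipschitz property ignores the exponent, so
    one sequence serves every [a]. *)
Lemma hoelder_dense_sequence d (M : closedRiemannianManifold R d) :
  exists g : nat -> M -> R, [/\ forall i, continuous (g i),
    forall i a, 0 < a <= 1 -> hoelder_space a (g i) &
    forall h (e : R), continuous h -> 0 < e ->
      exists i, forall x, `|g i x - h x| < e].
Proof.
have cM : compact [set: M] := @carrier_compact _ _ M.
have [I [phi [Lphi sep]]] := C1_lipschitz_separation M.
have cphi i : continuous (phi i).
  by have [K _ /C1_lipschitz_continuous] := Lphi i.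
have rphi i : rlip (phi i).
  by have [K K0 /(C1_lipschitz_rlipschitz K0)] := Lphi i; exists K => //; exact: ltW.
pose g n : M -> R := if unpickle n is Some p then lattice_fun phi p else cst 0.
have cg i : continuous (g i).
  by rewrite /g; case: unpickle => [p|]; [exact: lattice_fun_continuous|exact: cst_continuous].
exists g; split=> //.
- move=> i a a01; have [B _ gB] := compact_continuous_bounded cM (cg i).
  apply: rlip_hoelder_space gB => //; rewrite /g.
  case: unpickle => [p|]; last exact: rlip_cst.
  apply: (@lattice_fun_ind _ _ _ phi (@rlip _ _ M)).
  + exact: rlip_cst.
  + by move=> b c j; exact: rlip_affine.
  + exact: rlip_max.
  + exact: rlip_min.
- move=> h e ch e0; have [p hp] := lattice_fun_dense cM cphi sep ch e0.
  by exists (pickle p); rewrite /g pickleK.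
Qed.
End assembly.

Theorem theorem2p8 (R : realType) (d : nat) (M : closedRiemannianManifold R d)
    (m : probability (borel M) R) (hm : is_normalized_volume m)
    (beta : R) (beta_gt0 : 0 < beta)
    (f : M -> M) (hf : Diff1 beta f)
    (mu : probability (borel M) R) (hmu : ergodic_measure f mu)
    (hmix : exists C alpha gamma : R,
      [/\ 0 < C, 0 < alpha <= 1, 0 < gamma &
       forall (g : M -> R) (n N : nat), hoelder_space alpha g ->
         (1 <= n)%N -> (1 <= N)%N ->
         `| N%:R^-1 * (\sum_(n <= k < n + N) \int[m]_x g (iter k f x))
            - \int[mu]_x g x |
         <= C * fine (hoelder_norm alpha g) * expR (- gamma * (minn n N)%:R)]) :
  weakly_physical_full m f mu.
Proof.
have [C [a [c [_ a01 c0 rate]]]] := hmix.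
have [_ [_ _ [[cf _] _] _]] := hf.
have [inv erg] := hmu.
have [g [cg hg gdense]] := hoelder_dense_sequence M.
have cM : compact [set: M] := @carrier_compact _ _ M.
have ces h (e : R) : continuous h -> 0 < e -> exists N0, forall N, (N0 <= N)%N ->
    N%:R^-1 * (\sum_(k < N) \int[m]_x h (iter k f x)) <= \int[mu]_x h x + e.
  move=> ch e0; have [i hi] := gdense h (e / 4) ch (divr_gt0 e0 (ltr0Sn R 3)).
  (* The Hoelder norm of the fixed approximant [g i] is absorbed into the constant. *)
  apply: (@cesaro_of_rate R M f m mu (C * fine (hoelder_norm a (g i))) c (g i)) => //.
  by move=> n N; apply: rate; exact: hg.
have full := basin_full cf cg gdense inv erg ces.
split; last exact: full.
by split; [exact: (basin_measurable mu cf cg gdense)|rewrite full lte01].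
Qed.
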